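(* Let $\chi_1,\dots,\chi_k\in X(\mathbb F_q^* )$ be characters of $\mathbb F_q^*$ and let $n_1,\dots,n_k$ be integers with $\gcd(n_i,q)=1$. Assume that $\sum_{i=1}^kD_{\chi_i,n_i}=0$ in $\mathrm{Div}(X)$. Then for every character $\lambda$ of $\mathbb F_q^*$ one has $$\prod_i\frac{g(\lambda^{n_i}\chi_i)}{\lambda(n_i^{n_i})g(\chi_i)}=q^{m(\lambda)}$$ for some $m(\lambda)\in\mathbb Z$. In particular, if $\lambda^{n_i}\chi_i\ne1$ for all $i$, then $2m(\lambda)$ is the number of $i$ such that $\chi_i=1$.
   Context: $\mathbb F_q$ is a finite field and $\psi:\mathbb F_q\to\mathbb C^*$ is a fixed non-trivial additive character. For a character $\lambda$ of $\mathbb F_q^*$, $g(\lambda)=\sum_{x\in\mathbb F_q^*}\lambda(x)\psi(x)$ (so $g(1)=-1$). In $\lambda(n_i^{n_i})$ the number $n_i^{n_i}$ is viewed as an element of $\mathbb F_q^*$ (the $n_i$ may be negative). $X_d=X(\mathbb F_{q^d}^* )$ is the group of ($\mathbb C^*$-valued) characters of $\mathbb F_{q^d}^*$; for $d_1|d_2$, $X_{d_1}\subset X_{d_2}$ via composition with the norm $\mathbb F_{q^{d_2}}^*\to\mathbb F_{q^{d_1}}^*$; $X=\varinjlim_dX_d$. $\mathrm{Div}(X)$ is the free abelian group on the set $X$. For $\chi\in X$ and $n>0$ with $\gcd(n,q)=1$, $D_{\chi,n}=\sum_{\xi\in X:\ \xi^n=\chi}(\xi)$, and $D_{\chi^{-1},-n}=-D_{\chi,n}$.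 *)

(* Defs.v *)
From HB Require Import structures.
From mathcomp Require Import all_boot all_order all_algebra all_fingroup all_solvable all_field.
From mathcomp Require Import generic_quotient boolp classical_sets cardinality fsbigop reals complex.
From mathcomp.multinomials Require Import freeg.
From mathcomp Require Import ring.

Set Implicit Arguments.
Unset Strict Implicit.
Unset Printing Implicit Defensive.

Import GRing.Theory Num.Theory.
Local Open Scope ring_scope.
Local Open Scope quotient_scope.

(* A monoid morphism from a group to the field C takes nonzero values, so
   mulchar C K is the group of homomorphisms from K^* to C^*. *)
Section MulChar.
Context (C : fieldType) (K : finFieldType).

Definition is_mulchar (f : {ffun {unit K} -> C}) : bool :=
  (f 1%g == 1) && [forall x, forall y, f (x * y)%g == f x * f y].

Record mulchar := MulChar { mulchar_fun :> {ffun {unit K} -> C};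
                            mulcharP : is_mulchar mulchar_fun }.
HB.instance Definition _ := [isSub for mulchar_fun].
HB.instance Definition _ := [Choice of mulchar by <:].

Lemma is_mulcharP (f : {ffun {unit K} -> C}) :
  reflect (f 1%g = 1 /\ forall x y, f (x * y)%g = f x * f y) (is_mulchar f).
Proof.
apply: (iffP andP) => [[/eqP f1 /forallP fM]|[/eqP f1 fM]].
  by split=> // x y; apply/eqP; exact: (forallP (fM x)).
by split=> //; apply/forallP=> x; apply/forallP=> y; rewrite fM.
Qed.

Lemma mulchar1 (f : mulchar) : f 1%g = 1.
Proof. by have /is_mulcharP[] := mulcharP f. Qed.

Lemma mulcharM (f : mulchar) x y : f (x * y)%g = f x * f y.
Proof. by have /is_mulcharP[] := mulcharP f. Qed.

Lemma mulchar_neq0 (f : mulchar) x : f x != 0.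
Proof.
by apply/eqP=> fx0; have /eqP := mulchar1 f;
  rewrite -(mulgV x) mulcharM fx0 mul0r eq_sym oner_eq0.
Qed.

Lemma mulcharPext (f g : mulchar) : (forall x, f x = g x) -> f = g.
Proof. by move=> fg; apply/val_inj/ffunP. Qed.

Fact mulchar_one_subproof : is_mulchar [ffun=> 1].
Proof. by apply/is_mulcharP; split=> [|x y]; rewrite !ffunE ?mul1r. Qed.
Fact mulchar_mul_subproof (f g : mulchar) : is_mulchar [ffun x => f x * g x].
Proof.
apply/is_mulcharP; split=> [|x y]; rewrite !ffunE ?mulchar1 ?mul1r //.
by rewrite !mulcharM mulrACA.
Qed.
Fact mulchar_inv_subproof (f : mulchar) : is_mulchar [ffun x => (f x)^-1].
Proof.
apply/is_mulcharP; split=> [|x y]; rewrite !ffunE ?mulchar1 ?invr1 //.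
by rewrite mulcharM invfM.
Qed.

Definition mulchar_one := MulChar mulchar_one_subproof.
Definition mulchar_mul f g := MulChar (mulchar_mul_subproof f g).
Definition mulchar_inv f := MulChar (mulchar_inv_subproof f).

Fact mulchar_mulA : associative mulchar_mul.
Proof. by move=> f g h; apply: mulcharPext=> x; rewrite !ffunE mulrA. Qed.
Fact mulchar_mul1 : left_id mulchar_one mulchar_mul.
Proof. by move=> f; apply: mulcharPext=> x; rewrite !ffunE mul1r. Qed.
Fact mulchar_1mul : right_id mulchar_one mulchar_mul.
Proof. by move=> f; apply: mulcharPext=> x; rewrite !ffunE mulr1. Qed.
Fact mulchar_mulV : left_inverse mulchar_one mulchar_inv mulchar_mul.
Proof.
by move=> f; apply: mulcharPext=> x; rewrite !ffunE mulVf ?mulchar_neq0.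
Qed.
Fact mulchar_Vmul : right_inverse mulchar_one mulchar_inv mulchar_mul.
Proof.
by move=> f; apply: mulcharPext=> x; rewrite !ffunE mulfV ?mulchar_neq0.
Qed.
HB.instance Definition _ := isGroup.Build mulchar
  mulchar_mulA mulchar_mul1 mulchar_1mul mulchar_mulV mulchar_Vmul.

End MulChar.

Section Pullback.
Context (C : fieldType) (K L : finFieldType) (h : {unit L} -> {unit K}).
Context (hM : {morph h : x y / (x * y)%g}).

Fact pullback_subproof (f : mulchar C K) : is_mulchar [ffun x => f (h x)].
Proof.
have h1 : h 1%g = 1%g by apply: (mulgI (h 1%g)); rewrite -hM !mulg1.
by apply/is_mulcharP; split=> [|x y]; rewrite !ffunE ?h1 ?mulchar1 // hM mulcharM.
Qed.

Definition pullback (f : mulchar C K) : mulchar C L :=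
  MulChar (pullback_subproof f).

Lemma pullbackE f x : pullback f x = f (h x).
Proof. by rewrite ffunE. Qed.

Lemma pullbackM : {morph pullback : f g / (f * g)%g}.
Proof. by move=> f g; apply: mulcharPext=> x; rewrite !ffunE. Qed.

End Pullback.

Definition expgz (G : groupType) (x : G) (n : int) : G :=
  match n with Posz m => (x ^+ m)%g | Negz m => (x ^- m.+1)%g end.

(* The unit with value x; junk value 1 when x is not a unit. *)
Definition to_unit (K : finFieldType) (x : K) : {unit K} := insubd (1%g : {unit K}) x.

Definition additive_character (C : fieldType) (K : finFieldType) (psi : K -> C) :=
  psi 0 = 1 /\ {morph psi : x y / x + y >-> x * y}.

Definition nontrivial_character (C : fieldType) (K : finFieldType)
    (psi : K -> C) :=
  exists x, psi x <> 1.

Definition gauss (C : fieldType) (K : finFieldType) (psi : K -> C)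
    (lambda : mulchar C K) : C :=
  \sum_(x : {unit K}) lambda x * psi (val x).

Definition posint := {d : nat | (0 < d)%N}.

Definition posint_mul (d e : posint) : posint :=
  exist _ (sval d * sval e)%N
    (etrans (muln_gt0 _ _) (introT andP (conj (svalP d) (svalP e)))).

Record dirsys := DirSys {
  dobj : posint -> groupType;
  dmap : forall d e : posint, (sval d %| sval e)%N -> dobj d -> dobj e;
  dmapM : forall d e (h : (sval d %| sval e)%N),
    {morph dmap h : x y / (x * y)%g};
  dmap_id : forall d (h : (sval d %| sval d)%N) x, dmap h x = x;
  dmap_comp : forall d e f (h1 : (sval d %| sval e)%N)
      (h2 : (sval e %| sval f)%N) (h3 : (sval d %| sval f)%N) x,
    dmap h2 (dmap h1 x) = dmap h3 x }.

Section DirLim.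
Context (S : dirsys).

Definition predirlim := {d : posint & dobj S d}.
HB.instance Definition _ := Choice.on predirlim.

Definition dirlim_equiv (u v : predirlim) : bool :=
  `[< exists (d : posint) (hu : (sval (tag u) %| sval d)%N)
        (hv : (sval (tag v) %| sval d)%N),
        dmap hu (tagged u) = dmap hv (tagged v) >].

Lemma dirlim_equivP (u v : predirlim) :
  reflect (exists (d : posint) (hu : (sval (tag u) %| sval d)%N)
        (hv : (sval (tag v) %| sval d)%N),
        dmap hu (tagged u) = dmap hv (tagged v)) (dirlim_equiv u v).
Proof. exact: asboolP. Qed.

Lemma dvd_posint_mull d e : (sval d %| sval (posint_mul d e))%N.
Proof. exact: dvdn_mulr. Qed.
Lemma dvd_posint_mulr d e : (sval e %| sval (posint_mul d e))%N.
Proof. exact: dvdn_mull. Qed.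

Fact dirlim_equiv_refl : reflexive dirlim_equiv.
Proof. by move=> u; apply/dirlim_equivP; exists (tag u), (dvdnn _), (dvdnn _). Qed.
Fact dirlim_equiv_sym : symmetric dirlim_equiv.
Proof.
by move=> u v; apply/dirlim_equivP/dirlim_equivP=> -[d [hu [hv e]]];
  exists d, hv, hu.
Qed.
Fact dirlim_equiv_trans : transitive dirlim_equiv.
Proof.
move=> v u w /dirlim_equivP[d [hu [hv e]]] /dirlim_equivP[d' [hv' [hw e']]].
apply/dirlim_equivP; exists (posint_mul d d').
have hd := dvd_posint_mull d d'; have hd' := dvd_posint_mulr d d'.
exists (dvdn_trans hu hd), (dvdn_trans hw hd').
rewrite -(dmap_comp hu hd) e -(dmap_comp hw hd') -e'.
by rewrite (dmap_comp _ _ (dvdn_trans hv hd)) (dmap_comp _ _ (dvdn_trans hv hd)).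
Qed.

Canonical dirlim_equiv_rel := EquivRel dirlim_equiv
  dirlim_equiv_refl dirlim_equiv_sym dirlim_equiv_trans.

Definition dirlim := {eq_quot dirlim_equiv}.
HB.instance Definition _ := Choice.on dirlim.
HB.instance Definition _ := EqQuotient.on dirlim.

Definition dinj (d : posint) (x : dobj S d) : dirlim :=
  \pi_dirlim (Tagged (dobj S) x : predirlim).

Lemma dinjP d e (x : dobj S d) (y : dobj S e) :
  dinj x = dinj y <->
  exists (f : posint) (hd : (sval d %| sval f)%N) (he : (sval e %| sval f)%N),
    dmap hd x = dmap he y.
Proof.
split=> [/eqmodP/dirlim_equivP //|E].
by apply/eqmodP; apply/dirlim_equivP.
Qed.

Lemma dinj_map d e (h : (sval d %| sval e)%N) (x : dobj S d) :
  dinj (dmap h x) = dinj x.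
Proof.
by apply/dinjP; exists e, (dvdnn _), h; rewrite dmap_id.
Qed.

Lemma dinj_surj (u : dirlim) : exists d (x : dobj S d), u = dinj x.
Proof.
by elim/quotW: u => -[d x]; exists d, x.
Qed.

Definition dirlim_one : dirlim := @dinj (exist _ 1%N isT) 1%g.
Definition dirlim_inv (u : dirlim) : dirlim := dinj (tagged (repr u))^-1%g.
Definition dirlim_mul (u v : dirlim) : dirlim :=
  let: (u', v') := (repr u, repr v) in
  dinj (dmap (dvd_posint_mull (tag u') (tag v')) (tagged u') *
        dmap (dvd_posint_mulr (tag u') (tag v')) (tagged v'))%g.

Lemma dmap1 d e (h : (sval d %| sval e)%N) : dmap h (1%g : dobj S d) = 1%g.
Proof. by apply: (mulgI (dmap h 1%g)); rewrite -dmapM !mulg1. Qed.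

Lemma dmapV d e (h : (sval d %| sval e)%N) : {morph @dmap S d e h : x / x^-1%g}.
Proof.
by move=> x; apply: (mulgI (dmap h x)); rewrite -dmapM !mulgV dmap1.
Qed.

Lemma dinj_repr (u : dirlim) : dinj (tagged (repr u)) = u.
Proof. by rewrite /dinj; case: (repr u) (reprK u). Qed.

Lemma dirlim_mulE d (x y : dobj S d) :
  dirlim_mul (dinj x) (dinj y) = dinj (x * y)%g.
Proof.
rewrite /dirlim_mul.
case: (repr (dinj x)) (dinj_repr (dinj x)) => d1 x1 /= /dinjP[a [h1 [h2 E]]].
case: (repr (dinj y)) (dinj_repr (dinj y)) => d2 y1 /= /dinjP[b [k1 [k2 E']]].
have ha := dvdn_trans h2 (dvd_posint_mull a b).
pose f := posint_mul (posint_mul a b) (posint_mul d1 d2).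
have fab : (sval (posint_mul a b) %| sval f)%N by apply: dvd_posint_mull.
have fa := dvdn_trans (dvd_posint_mull a b) fab.
have fb := dvdn_trans (dvd_posint_mulr a b) fab.
have f12 : (sval (posint_mul d1 d2) %| sval f)%N by apply: dvd_posint_mulr.
have fd := dvdn_trans ha fab.
apply/dinjP; exists f, f12, fd; rewrite !dmapM.
rewrite (dmap_comp _ _ (dvdn_trans h1 fa)) -(dmap_comp h1 fa) E.
rewrite (dmap_comp _ _ (dvdn_trans k1 fb)) -(dmap_comp k1 fb) E'.
by rewrite !(dmap_comp _ _ fd).
Qed.

Lemma dirlim_invE d (x : dobj S d) : dirlim_inv (dinj x) = dinj x^-1%g.
Proof.
rewrite /dirlim_inv.
case: (repr (dinj x)) (dinj_repr (dinj x)) => d1 x1 /= /dinjP[a [h1 [h2 E]]].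
by apply/dinjP; exists a, h1, h2; rewrite !dmapV E.
Qed.

Lemma dirlim_oneE d : dirlim_one = dinj (1%g : dobj S d).
Proof. by apply/dinjP; exists d, (dvd1n _), (dvdnn _); rewrite !dmap1. Qed.

Lemma dinj2 (u v : dirlim) :
  exists d (x y : dobj S d), u = dinj x /\ v = dinj y.
Proof.
have [d [x ->]] := dinj_surj u; have [e [y ->]] := dinj_surj v.
exists (posint_mul d e), (dmap (dvd_posint_mull d e) x),
  (dmap (dvd_posint_mulr d e) y).
by rewrite !dinj_map.
Qed.

Fact dirlim_mulA : associative dirlim_mul.
Proof.
move=> u v w; have [d [x [y [-> ->]]]] := dinj2 u v.
have [e [z ->]] := dinj_surj w.
rewrite -(dinj_map (dvd_posint_mull d e) x) -(dinj_map (dvd_posint_mull d e) y).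
by rewrite -(dinj_map (dvd_posint_mulr d e) z) !dirlim_mulE mulgA.
Qed.
Fact dirlim_mul1 : left_id dirlim_one dirlim_mul.
Proof.
by move=> u; have [d [x ->]] := dinj_surj u;
  rewrite (dirlim_oneE d) dirlim_mulE mul1g.
Qed.
Fact dirlim_1mul : right_id dirlim_one dirlim_mul.
Proof.
by move=> u; have [d [x ->]] := dinj_surj u;
  rewrite (dirlim_oneE d) dirlim_mulE mulg1.
Qed.
Fact dirlim_mulV : left_inverse dirlim_one dirlim_inv dirlim_mul.
Proof.
by move=> u; have [d [x ->]] := dinj_surj u;
  rewrite dirlim_invE dirlim_mulE mulVg -dirlim_oneE.
Qed.
Fact dirlim_Vmul : right_inverse dirlim_one dirlim_inv dirlim_mul.
Proof.
by move=> u; have [d [x ->]] := dinj_surj u;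
  rewrite dirlim_invE dirlim_mulE mulgV -dirlim_oneE.
Qed.
HB.instance Definition _ := isGroup.Build dirlim
  dirlim_mulA dirlim_mul1 dirlim_1mul dirlim_mulV dirlim_Vmul.

Lemma dinjM d : {morph @dinj d : x y / (x * y)%g}.
Proof. by move=> x y; rewrite -dirlim_mulE. Qed.

End DirLim.

Definition algclosure (F : finFieldType) : countClosedFieldType :=
  projT1 (countable_algebraic_closure F).

Definition to_algclosure (F : finFieldType) : {rmorphism F -> algclosure F} :=
  tag (tagged (countable_algebraic_closure F)).

Section Extension.
Context (F : finFieldType).
Local Notation Fbar := (algclosure F).
Local Notation iota := (to_algclosure F).
Local Notation q := #|F|.

Lemma q_gt1 : (1 < q)%N. Proof. exact: finNzRing_gt1. Qed.

Lemma qX_pnat n : [pchar Fbar].-nat (q ^ n)%N.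
Proof.
have [p p_pr pF] := finPcharP F.
have pFbar : p \in [pchar Fbar] by rewrite (fmorph_pchar iota).
rewrite (eq_pnat _ (pcharf_eq pFbar)) pnatX; apply/orP; left.
by have := abelem_pgroup (fin_ring_pchar_abelem pF); rewrite /pgroup cardsT.
Qed.

Lemma frobD n (x y : Fbar) : (x + y) ^+ (q ^ n) = x ^+ (q ^ n) + y ^+ (q ^ n).
Proof. by rewrite exprDn_pchar ?qX_pnat. Qed.

Lemma frobN n (x : Fbar) : (- x) ^+ (q ^ n) = - x ^+ (q ^ n).
Proof. by rewrite exprNn_pchar ?qX_pnat. Qed.

Section Degree.
Context (d : posint).

Definition in_ext : pred Fbar := fun x => x ^+ (q ^ sval d) == x.

Fact in_ext_divring_closed : divring_closed in_ext.
Proof.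
split=> [|x y /eqP xE /eqP yE|x y /eqP xE /eqP yE]; rewrite unfold_in.
- by rewrite expr1n.
- by rewrite frobD frobN xE yE.
- by rewrite expr_div_n xE yE.
Qed.
HB.instance Definition _ := GRing.isDivringClosed.Build Fbar in_ext
  in_ext_divring_closed.

(* The subfield of order q ^ d of the algebraic closure. *)
Record ext := Ext { ext_val :> Fbar; extP : ext_val \in in_ext }.
HB.instance Definition _ := [isSub for ext_val].
HB.instance Definition _ := [Countable of ext by <:].
HB.instance Definition _ := [SubChoice_isSubComUnitRing of ext by <:].
HB.instance Definition _ := [SubComUnitRing_isSubIntegralDomain of ext by <:].
HB.instance Definition _ := [SubIntegralDomain_isSubField of ext by <:].

Lemma extE (x : ext) : (val x) ^+ (q ^ sval d) = val x.
Proof. exact/eqP/(extP x). Qed.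

Lemma ext_finite : {s : seq Fbar | {subset in_ext <= s}}.
Proof.
have [s sE] := closed_field_poly_normal ('X^(q ^ sval d) - 'X : {poly Fbar}).
exists s => x /eqP xE; set p := ('X^_ - 'X) in sE.
have p0 : p != 0.
  rewrite -size_poly_gt0 size_polyDl ?size_polyXn // size_polyN size_polyX ltnS.
  by rewrite -[X in (X < _)%N](expn0 q) ltn_exp2l ?q_gt1 ?(svalP d).
have : root p x by rewrite rootE !hornerE xE subrr.
by rewrite sE rootZ ?lead_coef_eq0 // root_prod_XsubC.
Qed.

Definition ext_enum : seq ext := pmap insub (undup (sval ext_finite)).

Fact ext_enumP : Finite.axiom ext_enum.
Proof.
have us : uniq (undup (sval ext_finite)) by exact: undup_uniq.
move=> x; rewrite count_uniq_mem ?(pmap_sub_uniq _ us) //.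
rewrite mem_pmap_sub mem_undup (svalP ext_finite) //; exact: extP.
Qed.
HB.instance Definition _ := isFinite.Build ext ext_enumP.

End Degree.

Section Norm.
Context (d e : posint) (de : (sval d %| sval e)%N).

(* The norm from the extension of degree e to the extension of degree d is the
   product of the conjugates under the Galois group, which is generated by
   x |-> x ^ (q ^ d) and has order e / d. *)
Definition norm_val (x : Fbar) : Fbar :=
  \prod_(i < sval e %/ sval d) x ^+ (q ^ (sval d * i)).

Lemma norm_valM : {morph norm_val : x y / x * y}.
Proof. by move=> x y; rewrite -big_split; apply: eq_bigr => i _; rewrite exprMn. Qed.

Fact norm_subproof (x : ext e) : norm_val (val x) \in in_ext d.
Proof.
rewrite unfold_in; apply/eqP; rewrite /norm_val -prodrXl.
have n_gt0 : (0 < sval e %/ sval d)%N.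
  by rewrite divn_gt0 ?(svalP d) // dvdn_leq ?(svalP e).
have E (i : nat) : (val x ^+ (q ^ (sval d * i))) ^+ (q ^ sval d)
    = val x ^+ (q ^ (sval d * i.+1)) by rewrite -exprM -expnD mulnS addnC.
under eq_bigr do rewrite E.
have := divnK de; move: n_gt0; case: (_ %/ _)%N => // n _ eE.
rewrite big_ord_recr big_ord_recl /= mulrC; congr (_ * _).
by rewrite mulnC eE muln0 expn0 expr1 extE.
Qed.

Definition norm (x : ext e) : ext d := Ext (norm_subproof x).

Lemma normM : {morph norm : x y / x * y}.
Proof. by move=> x y; apply: val_inj; rewrite /= norm_valM. Qed.

Lemma norm1 : norm 1 = 1.
Proof.
by apply: val_inj; rewrite /= /norm_val big1 // => i _; rewrite expr1n.
Qed.

Fact norm_unit_subproof (u : {unit ext e}) : norm (val u) \is a GRing.unit.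
Proof.
apply/unitrP; exists (norm (val u^-1%g)).
by rewrite -!normM mulVr ?mulrV ?(valP u) ?norm1.
Qed.

Definition norm_unit (u : {unit ext e}) : {unit ext d} :=
  FinRing.unit (ext d) (norm_unit_subproof u).

Lemma norm_unitM : {morph norm_unit : x y / (x * y)%g}.
Proof. by move=> u v; apply: val_inj; rewrite /= normM. Qed.

End Norm.

Lemma norm_unit_id d (dd : (sval d %| sval d)%N) u : norm_unit dd u = u.
Proof.
apply/val_inj/val_inj; rewrite /= /norm_val divnn (svalP d) big_ord1.
by rewrite muln0 expn0 expr1.
Qed.

Lemma norm_unit_comp d e f (de : (sval d %| sval e)%N) (ef : (sval e %| sval f)%N)
  (df : (sval d %| sval f)%N) u : norm_unit de (norm_unit ef u) = norm_unit df u.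
Proof.
apply/val_inj/val_inj; rewrite /= /norm_val.
move: (val (val u)) => x.
set m := (sval e %/ sval d)%N; set n := (sval f %/ sval e)%N.
have -> : (sval f %/ sval d)%N = (n * m)%N.
  by rewrite -(divnK ef) -/n -(divnK de) -/m mulnA mulnK ?(svalP d).
have eE : sval e = (m * sval d)%N by rewrite /m divnK.
under eq_bigr do rewrite -prodrXl.
rewrite -(big_mkord xpredT (fun k => x ^+ (q ^ (sval d * k)))).
rewrite big_nat_mul big_mkord exchange_big /=; apply: eq_bigr => j _.
rewrite -{1}[(j * m)%N]add0n big_addn mulSn addnK big_mkord.
apply: eq_bigr => i _; rewrite -exprM -expnD; congr (_ ^+ (_ ^ _)).
by rewrite eE; ring.
Qed.

Definition posint1 : posint := exist _ 1%N isT.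

Lemma ext1_base (x : ext posint1) : exists y, iota y == val x.
Proof.
have : root (map_poly iota ('X^q - 'X)) (val x).
  by rewrite rmorphB /= map_polyXn map_polyX rootE !hornerE -{1}(expn1 q) extE subrr.
rewrite finField_genPoly rmorph_prod /=.
under eq_bigr do rewrite rmorphB /= map_polyX map_polyC.
rewrite -big_enum -(big_map iota xpredT (fun z => 'X - z%:P)) root_prod_XsubC.
by case/mapP=> y _ ->; exists y; apply: eqxx.
Qed.

(* The inverse of the isomorphism iota from F to the extension of degree 1. *)
Definition base (x : ext posint1) : F := xchoose (ext1_base x).

Lemma baseK x : iota (base x) = val x.
Proof. exact: eqP (xchooseP (ext1_base x)). Qed.

Lemma baseM : {morph base : x y / x * y}.
Proof. by move=> x y; apply: (fmorph_inj iota); rewrite rmorphM !baseK. Qed.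

Fact base_unit_subproof (u : {unit ext posint1}) : base (val u) \is a GRing.unit.
Proof.
by rewrite unitfE -(fmorph_eq0 iota) baseK; have := valP u; rewrite unitfE.
Qed.

Definition base_unit (u : {unit ext posint1}) : {unit F} :=
  FinRing.unit F (base_unit_subproof u).

Lemma base_unitM : {morph base_unit : x y / (x * y)%g}.
Proof. by move=> u v; apply: val_inj; rewrite /= baseM. Qed.

End Extension.

Lemma card_ext (F : finFieldType) d : #|{: ext F d}| = (#|F| ^ sval d)%N.
Proof.
have [s sE] := closed_field_poly_normal ('X^(#|F| ^ sval d) - 'X : {poly algclosure F}).
set p := LHS in sE.
have d1 : (1 < #|F| ^ sval d)%N by rewrite -[X in (X < _)%N](expn0 #|F|) ltn_exp2l ?q_gt1 ?(svalP d).
have szp : size p = (#|F| ^ sval d).+1 by rewrite size_polyDl ?size_polyXn // size_polyN size_polyX.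
have lp : lead_coef p = 1 by rewrite lead_coefDl ?lead_coefXn ?size_polyXn // size_polyN size_polyX.
rewrite lp scale1r in sE.
have us : uniq s.
  rewrite -separable_prod_XsubC -sE separable_poly.unlock.
  have -> : p^`() = -1.
    rewrite derivB derivXn derivX -mulr_natr -polyC_natr.
    suff -> : (#|F| ^ sval d)%:R = 0 :> algclosure F by rewrite mulr0 sub0r.
    have [pp p_pr pF] := finPcharP F.
    have pFbar : pp \in [pchar algclosure F] by rewrite (fmorph_pchar (to_algclosure F)).
    apply/eqP; rewrite -(dvdn_pcharf pFbar).
    have := qX_pnat F (sval d); rewrite (eq_pnat _ (pcharf_eq pFbar)) => /p_natP [e Ee].
    by move: d1; rewrite Ee; case: e {Ee} => // e _; rewrite expnS dvdn_mulr.
  rewrite -scaleN1r coprimepZr ?coprimep1 ?oppr_eq0 ?oner_eq0 //.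
have -> : #|{: ext F d}| = size s.
  rewrite cardE.
  have -> : size (enum {: ext F d}) = size (map val (enum {: ext F d})) by rewrite size_map.
  apply/perm_size/uniq_perm => //; first by rewrite (map_inj_uniq val_inj) enum_uniq.
  move=> x; rewrite -[x \in s]root_prod_XsubC -sE rootE !hornerE subr_eq0.
  apply/mapP/idP => [[y _ ->]|xE]; first by apply/eqP/extE.
  by exists (Ext xE); rewrite // mem_enum.
have := size_prod_XsubC s id; rewrite -sE szp; by case.
Qed.

Section Limit.
Context (C : fieldType) (F : finFieldType).

Definition char_map (d e : posint) (de : (sval d %| sval e)%N) :
    mulchar C (ext F d) -> mulchar C (ext F e) :=
  pullback (@norm_unitM F d e de).

Fact char_map_id d (dd : (sval d %| sval d)%N) x : char_map dd x = x.
Proof. by apply: mulcharPext => u; rewrite pullbackE norm_unit_id. Qed.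

Fact char_map_comp d e f (de : (sval d %| sval e)%N) (ef : (sval e %| sval f)%N)
  (df : (sval d %| sval f)%N) x : char_map ef (char_map de x) = char_map df x.
Proof.
by apply: mulcharPext => u; rewrite !pullbackE (norm_unit_comp _ _ df).
Qed.

Definition char_system : dirsys :=
  @DirSys (fun d => mulchar C (ext F d)) char_map
    (fun d e de => pullbackM _) char_map_id char_map_comp.

Definition charlim := dirlim char_system.
HB.instance Definition _ := Group.on charlim.

(* The embedding of the characters of F^* into the limit, F being identified
   with the extension of degree 1. *)
Definition to_charlim (chi : mulchar C F) : charlim :=
  @dinj char_system posint1 (pullback (@base_unitM F) chi).

End Limit.

Lemma mulchar_torsion (C : fieldType) (K : finFieldType) (n : nat) (c : mulchar C K)
  (s : seq (mulchar C K)) : (0 < n)%N -> uniq s ->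
  (forall f, f \in s -> (f ^+ n)%g = c) -> (size s <= n)%N.
Proof.
move=> n0 us sn.
have /cyclicP[g gE] := field_unit_group_cyclic [set: {unit K}].
have fX (f : mulchar C K) x m : (f ^+ m)%g x = f x ^+ m.
  elim: m => [|m IH]; first by rewrite expg0 expr0 /= ffunE.
  by rewrite expgS exprS /= ffunE IH.
have fXr (f : mulchar C K) x m : f (x ^+ m)%g = f x ^+ m.
  elim: m => [|m IH]; first by rewrite expg0 expr0 mulchar1.
  by rewrite expgS exprS mulcharM IH.
pose p : {poly C} := 'X^n - (c g)%:P.
have sp : size p = n.+1 by rewrite size_polyDl ?size_polyXn // size_polyN size_polyC; case: (_ != 0).
have p0 : p != 0 by rewrite -size_poly_gt0 sp.
rewrite -ltnS -sp -(size_map (fun f : mulchar C K => f g)).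
apply: max_poly_roots => //.
  apply/allP=> _ /mapP[f fs ->]; rewrite rootE !hornerE -fX (sn f fs) subrr //.
rewrite map_inj_uniq // => f f' ff'; apply: mulcharPext => x.
have : x \in <[g]>%g by rewrite -gE inE.
by case/cycleP => i ->; rewrite !fXr ff'.
Qed.

Lemma charlim_torsion_size (C : fieldType) (F : finFieldType) (chi : charlim C F) n
  (s : seq (charlim C F)) : (0 < n)%N -> uniq s ->
  (forall f, f \in s -> (f ^+ n)%g = chi) -> (size s <= n)%N.
Proof.
move=> n0 us sn.
have [d [c [t [cE [sE tn]]]]] : exists d (c : mulchar C (ext F d)) (t : seq (mulchar C (ext F d))),
    chi = @dinj (char_system C F) d c /\ s = map (@dinj (char_system C F) d) t /\
    forall f, f \in t -> (f ^+ n)%g = c.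
  elim: s sn {us} => [|x s IH] sn.
    by have [d [c ->]] := dinj_surj chi; exists d, c, [::].
  have [|d [c [t [cE [sE tn]]]]] := IH; first by move=> f fs; apply: sn; rewrite inE fs orbT.
  have [e [y yE]] := dinj_surj x.
  have := sn x (mem_head _ _); rewrite {1}yE cE.
  have dX a (z : dobj (char_system C F) a) m : (@dinj (char_system C F) a z ^+ m)%g = dinj (z ^+ m)%g.
    elim: m => [|m H]; first by rewrite !expg0; exact: dirlim_oneE.
    by rewrite !expgS dinjM H.
  have mX a b (h : (sval a %| sval b)%N) (z : mulchar C (ext F a)) m :
     char_map h (z ^+ m)%g = (char_map h z ^+ m)%g.
    elim: m => [|m H]; first by rewrite !expg0; exact: (@dmap1 (char_system C F)).
    by rewrite !expgS /char_map pullbackM -/(char_map h) H.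
  rewrite dX => /dinjP[f [h1 [h2 E]]].
  exists f, (char_map h2 c), (char_map h1 y :: map (char_map h2) t); split.
    by rewrite -(@dinj_map (char_system C F) _ _ h2).
  split.
    rewrite /= (@dinj_map (char_system C F) _ _ h1) -yE; congr (_ :: _).
    rewrite sE -map_comp; apply: eq_map => z /=.
    by rewrite (@dinj_map (char_system C F) _ _ h2).
  move=> z; rewrite inE => /orP[/eqP ->|/mapP[w wt ->]]; rewrite -mX; last by rewrite tn.
  exact: E.
rewrite sE size_map; apply: mulchar_torsion tn => //.
by apply: (@map_uniq _ _ (@dinj (char_system C F) d)); rewrite -sE.
Qed.

Lemma charlim_torsion_finite (C : fieldType) (F : finFieldType) (chi : charlim C F) n :
  (0 < n)%N -> finite_set [set xi : charlim C F | (xi ^+ n)%g = chi]%classic.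
Proof.
move=> n0; apply: contrapT; set A := [set _ | _]%classic => infA.
have [s us [szs sA]] : exists2 s : seq (charlim C F), uniq s &
    size s = n.+1 /\ forall f, f \in s -> A f.
  elim: n.+1 => [|m [s us [szs sA]]]; first by exists [::].
  have /infinite_setN0[x [Ax xs]] : infinite_set (A `\` [set` s])%classic.
    by apply: infinite_setD => //; exact: finite_seq.
  exists (x :: s); first by rewrite /= us andbT; apply/negP.
  split=> [|f]; first by rewrite /= szs.
  by rewrite inE => /orP[/eqP ->//|]; exact: sA.
by have := charlim_torsion_size n0 us sA; rewrite szs ltnn.
Qed.

Section Divisors.
Context (C : fieldType) (F : finFieldType).

Definition divisor := {freeg (charlim C F)}.
HB.instance Definition _ := GRing.Zmodule.on divisor.

(* By charlim_torsion_finite, for n > 0 this is a genuine finite sum and not the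
   default value 0 of a sum with infinite support. *)
Definition Dpos (chi : charlim C F) (n : nat) : divisor :=
  \sum_(xi \in [set xi : charlim C F | (xi ^+ n)%g = chi]%classic) (<< xi >> : divisor).

(* The value at n = 0 is irrelevant. *)
Definition D (chi : charlim C F) (n : int) : divisor :=
  match n with Posz m => Dpos chi m | Negz m => - Dpos chi^-1%g m.+1 end.

End Divisors.

(* Main.v *)
Require Import Defs.
From HB Require Import structures.
From mathcomp Require Import finmap boolp classical_sets cardinality fsbigop.
From mathcomp Require Import all_boot all_order all_algebra all_fingroup all_solvable all_field.
From mathcomp.multinomials Require Import freeg.
From mathcomp Require Import ring zify.
From mathcomp Require Import reals complex.

Set Implicit Arguments.
Unset Strict Implicit.
Unset Printing Implicit Defensive.

Import Order.TTheory GRing.Theory Num.Theory.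

(** Let q be the order of F and let F_r be the extension of F of degree r.  For
    n >= 1 prime to q and a character eta of the units of F, consider the
    L-function of the sums of eta(x) psi(x ^ n).  Concretely, for a polynomial u
    over F with u(0) = 1 and degree m, put
      Lambda(u) = eta((-1)^m * leading coefficient of u)
                  * psi(sum of the n-th powers of the inverse roots of u),
    and let L(eta, n; T) be the sum of Lambda(u) T^m over all u.

    The power sums attached to L are S_r, the sum over the units x of F_r of
    eta(N x) psi(Tr(x ^ n)).  Indeed Lambda is multiplicative, and a polynomial u
    of degree m is divisible by the reciprocal characteristic polynomial of x for
    exactly m pairs (r, x) with x in F_r, which gives Newton's identities
    m a_m = sum of S_r a_(m - r) for the coefficients a_m of L (Lcoef_newton).

    L is a polynomial of degree exactly n, and its leading coefficient is
    c_n g(eta) / eta((-1)^(n - 1) n) with c_n nonzero and independent of eta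
    (Lcoef_gt, Lcoef_top, Lconst_neq0).  The reason is that the n-th power sum
    is affine, with slope - n, in the coefficient of X^n in u, and ignores the
    coefficients of higher index; that c_n is nonzero is an exact stationary
    phase computation.

    For eta = lambda^n chi, duality on the units of F_r turns S_r into the sum
    of the Gauss sums over F_r of lambda xi, where xi runs over the characters
    of F_r with xi^n = chi (Lpow_sum).  Since the characters of F_r inject into
    the direct limit, this is a linear function of the divisor D(chi, n).  The
    relation between the divisors therefore makes the product of the L-functions
    of the pairs (lambda^n_i chi_i, n_i) with n_i > 0 and the product of those of
    the pairs (lambda^(- n_i) chi_i^-1, - n_i) with n_i < 0 have the same power
    sums, hence coincide (prod_Lpoly).  Leading coefficients then coincide too;
    dividing the equality for lambda by the one for the trivial character
    cancels the c_n and leaves the ratios g(lambda^n chi) / (lambda(n^n) g(chi))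
    (prod_ratio).

    It remains to rewrite the factors with n_i < 0 by means of
    g(mu) g(mu^-1) = mu(-1) q for mu nontrivial, and g(1)^2 = 1: these are the
    source of the power of q (gauss_factor_neg).  For the value of the exponent,
    the coefficient of the trivial character in the relation between divisors
    says that chi_i = 1 holds equally often for positive and for negative n_i
    (card_trivial). *)

(** * Orbits of an injection inside an invariant multiset *)

Section OrbitCount.
Context (T : eqType) (f : T -> T) (s : seq T).
Context (f_inj : injective f).
Context (s_stable : forall w, count_mem (f w) s = count_mem w s).

(** Inclusion of multisets: sequences are compared with their multiplicities. *)
Definition submset (t s : seq T) := all (fun w => count_mem w t <= count_mem w s) t.

Lemma submsetP t s' : reflect (forall w, count_mem w t <= count_mem w s') (submset t s').
Proof.
apply: (iffP allP) => [h w|h w _]; last exact: h.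
have [/h//|wt] := boolP (w \in t).
by rewrite (count_memPn wt).
Qed.

Lemma submset_size t s' : submset t s' -> size t <= size s'.
Proof.
by move/submsetP/count_subseqP => [u us /perm_size ->]; exact: size_subseq.
Qed.

Lemma count_iter z i : count_mem (iter i f z) s = count_mem z s.
Proof. by elim: i => //= i <-; exact: s_stable. Qed.

Lemma iter_inj i : injective (iter i f).
Proof. by elim: i => // i IH x y /= /f_inj /IH. Qed.

(** All iterates of z lie in s, so the first size s + 1 of them cannot be
    pairwise distinct. *)
Lemma period_ex z : z \in s -> exists d, (0 < d) && (iter d f z == z).
Proof.
move=> zs; have loop : looping f z (size s).
  rewrite -[looping _ _ _]negbK -looping_uniq; apply/negP => /uniq_leq_size.
  move=> /(_ s) h; have : size (traject f z (size s).+1) <= size s.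
    apply: h => w /trajectP[i _ ->].
    by rewrite -has_pred1 has_count count_iter -has_count has_pred1.
  by rewrite size_traject ltnn.
have /trajectP[i ilt iE] := loop.
exists (size s - i); rewrite subn_gt0 ilt /=; apply/eqP/(@iter_inj i).
by rewrite -iterD subnKC // ltnW.
Qed.

(** Let d be the period of z.  The first r iterates of z close up exactly when d
    divides r, and they then run r / d times through the orbit, on which the
    multiplicity in s is constant.  So the admissible r are the j * d with
    1 <= j <= count_mem z s; the bound r <= size s is automatic for them. *)
Lemma orbit_count z : z \in s ->
  count (fun r => (iter r f z == z) && submset (traject f z r) s) (iota 1 (size s))
  = count_mem z s.
Proof.
move=> zs; have ex := period_ex zs.
case: (ex_minnP ex) => d /andP[d0 /eqP dz] dmin.
have per j : iter (j * d) f z = z.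
  by elim: j => // j IH; rewrite mulSn iterD IH.
have ud : uniq (traject f z d).
  case: d d0 dz dmin {per} => // d _ dz dmin; rewrite looping_uniq.
  apply/negP => /trajectP[i ilt iE].
  have := dmin (d - i); rewrite subn_gt0 ilt /= => /(_ _) h.
  have : d < d - i; last by rewrite ltnNge leq_subr.
  apply: h; apply/eqP/(@iter_inj i); rewrite -iterD subnKC //; exact: ltnW.
(* j * d iterates run j times through the orbit, whose d points are distinct. *)
have cnt j w : count_mem w (traject f z (j * d)) = j * (w \in traject f z d).
  rewrite -(count_uniq_mem _ ud); elim: j => // j IH.
  rewrite mulSn addnC trajectD count_cat IH per mulSn addnC //.
have zd : z \in traject f z d by case: d d0 {dz dmin per ud cnt} => // d _; rewrite /= inE eqxx.
rewrite -size_filter -[RHS](size_iota 1) -[RHS](size_map (fun j => j * d)).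
apply/perm_size/uniq_perm; first by rewrite filter_uniq ?iota_uniq.
  by rewrite map_inj_uniq ?iota_uniq // => i j /eqP; rewrite eqn_pmul2r // => /eqP.
move=> r; rewrite mem_filter mem_iota; apply/idP/mapP.
  move=> /andP[/andP[/eqP rz /submsetP sub] /andP[r0 rs]].
  have rd : r %% d = 0.
    apply/eqP; rewrite -leqn0 leqNgt; apply/negP => rd0.
    have := dmin (r %% d); rewrite rd0 /= => h.
    have : d <= r %% d; last by rewrite leqNgt ltn_mod d0.
    apply: h; apply/eqP; rewrite -[RHS]rz {2}(divn_eq r d) addnC iterD per //.
  have rE : r = r %/ d * d by rewrite {1}(divn_eq r d) rd addn0.
  exists (r %/ d) => //; rewrite mem_iota add1n ltnS.
  apply/andP; split; first by move: r0; rewrite {1}rE; case: (r %/ d).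
  by have := sub z; rewrite {1}rE cnt zd muln1.
move=> [j]; rewrite mem_iota add1n ltnS => /andP[j0 jm] ->.
have sub : submset (traject f z (j * d)) s.
  apply/submsetP => w; rewrite cnt; have [/trajectP[i _ ->]|_] := boolP (w \in _).
    by rewrite muln1 count_iter.
  by rewrite muln0.
rewrite per eqxx sub muln_gt0 j0 d0 /= add1n ltnS.
by have := submset_size sub; rewrite size_traject.
Qed.

End OrbitCount.

Local Open Scope ring_scope.

Lemma dvdp_prod_submset (K : fieldType) (t s : seq K) :
  (\prod_(z <- t) ('X - z%:P) %| \prod_(z <- s) ('X - z%:P)) = submset t s.
Proof.
have neq0 (l : seq K) : \prod_(z <- l) ('X - z%:P) != 0 by rewrite monic_neq0 ?monic_prod_XsubC.
apply/idP/submsetP => [dv w|/count_subseqP[t' /perm_to_subseq[s' ps] pt]].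
  rewrite -!mu_prod_XsubC mup_geq //; apply: dvdp_trans dv.
  by rewrite -mup_geq.
by rewrite (perm_big _ pt) (perm_big _ ps) big_cat /= dvdp_mulr.
Qed.

(** * Power sums of inverse roots *)
Section Truncation.
Context (R : comNzRingType).
Implicit Types (p q u v : {poly R}) (N n : nat).

Definition eq_modX N p q := forall i, (i < N)%N -> p`_i = q`_i.

Lemma eq_modXM N p p' q q' : eq_modX N p p' -> eq_modX N q q' -> eq_modX N (p * q) (p' * q').
Proof.
move=> pp' qq' i iN; rewrite !coefM; apply: eq_bigr => j _.
rewrite pp' ?qq' //; first exact: leq_ltn_trans (leq_subr _ _) iN.
by apply: leq_ltn_trans iN; rewrite -ltnS.
Qed.

Lemma eq_modX_trans N p q r : eq_modX N p q -> eq_modX N q r -> eq_modX N p r.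
Proof. by move=> pq qr i iN; rewrite pq ?qr. Qed.

Lemma coef_exp_lt p n i : p`_0 = 0 -> (i < n)%N -> (p ^+ n)`_i = 0.
Proof.
move=> p0 lt_in; have /factor_theorem[q ->] : root p 0 by rewrite rootE horner_coef0 p0.
by rewrite subr0 exprMn coefMXn lt_in.
Qed.

(** The truncated geometric series: an inverse of u modulo X^N when u(0) = 1. *)
Definition truncinv N u := \sum_(k < N) (1 - u) ^+ k.

Lemma truncinvK N u : u`_0 = 1 -> eq_modX N (u * truncinv N u) 1.
Proof.
move=> u0 i iN; have -> : u * truncinv N u = 1 - (1 - u) ^+ N.
  by rewrite -[RHS]opprB subrX1 /truncinv; ring.
by rewrite coefB (coef_exp_lt _ iN) ?subr0 // coefB coef1 u0 subrr.
Qed.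

(** The coefficient of X^n in - X u'/u.  If u is the product of the 1 - a_j X,
    this is the sum of the a_j^n (Newton); the logarithmic derivative gives it
    over the ring of coefficients of u. *)
Definition psum n u := (- (u^`() * truncinv n u))`_n.-1.

(** Any inverse of u modulo X^n can be used to compute the logarithmic
    derivative. *)
Lemma psum_inv n u v : (0 < n)%N -> u`_0 = 1 -> eq_modX n (u * v) 1 ->
  psum n u = - (u^`() * v)`_n.-1.
Proof.
move=> n0 u0 uv; rewrite /psum coefN; congr (- _).
have ltn1 : (n.-1 < n)%N by rewrite prednK.
suff E : eq_modX n (truncinv n u) v by rewrite (eq_modXM (p' := u^`()) _ E).
apply: (eq_modX_trans (q := v * (u * truncinv n u))).
  rewrite mulrA [v * u]mulrC -{1}[truncinv n u]mul1r.
  by apply: eq_modXM => // i iN; rewrite uv.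
by rewrite -[X in eq_modX n _ X]mulr1; apply: eq_modXM => //; apply: truncinvK.
Qed.

Lemma coef0M u v : (u * v)`_0 = u`_0 * v`_0.
Proof. by rewrite coefM big_ord1. Qed.

Lemma truncinv_coef0 N u : (0 < N)%N -> u`_0 = 1 -> (truncinv N u)`_0 = 1.
Proof. by move=> N0 u0; have := truncinvK u0 N0; rewrite coef0M u0 mul1r coef1. Qed.

Lemma psumM n u v : (0 < n)%N -> u`_0 = 1 -> v`_0 = 1 ->
  psum n (u * v) = psum n u + psum n v.
Proof.
move=> n0 u0 v0; have ltn1 : (n.-1 < n)%N by rewrite prednK.
set a := truncinv n u; set b := truncinv n v.
have uK : eq_modX n (u * a) 1 by exact: truncinvK.
have vK : eq_modX n (v * b) 1 by exact: truncinvK.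
rewrite (@psum_inv _ _ (a * b)) //; last 2 first.
- by rewrite coef0M u0 v0 mulr1.
- rewrite mulrACA -[X in eq_modX n _ X]mulr1; exact: eq_modXM.
have -> : (u * v)^`() * (a * b) = u^`() * a * (v * b) + v^`() * b * (u * a).
  by rewrite derivM; ring.
rewrite coefD opprD /psum !coefN -/a -/b.
by rewrite (eq_modXM (p' := u^`() * a) _ vK) // (eq_modXM (p' := v^`() * b) _ uK) // !mulr1.
Qed.

Lemma psum_ext n u v : (0 < n)%N -> u`_0 = 1 -> eq_modX n.+1 u v -> psum n u = psum n v.
Proof.
move=> n0 u0 uv; have ltn1 : (n.-1 < n)%N by rewrite prednK.
have v0 : v`_0 = 1 by rewrite -uv.
rewrite (@psum_inv n u (truncinv n v)) //; last first.
  apply: eq_modX_trans (truncinvK v0); apply: eq_modXM => // i iN; apply: uv.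
  exact: leqW.
rewrite /psum coefN; congr (- _); apply: eq_modXM ltn1 => // i iN.
by rewrite !coef_deriv uv.
Qed.

Lemma psum_addXn n u (c : R) : (0 < n)%N -> u`_0 = 1 ->
  psum n (u + c *: 'X^n) = psum n u - c *+ n.
Proof.
move=> n0 u0; have ltn1 : (n.-1 < n)%N by rewrite prednK.
have v0 : (u + c *: 'X^n)`_0 = 1.
  by rewrite coefD coefZ coefXn u0; case: n n0 {ltn1} => //= n _; rewrite mulr0 addr0.
rewrite (@psum_inv _ _ (truncinv n u)) //; last first.
  apply: eq_modX_trans (truncinvK u0); apply: eq_modXM => // i iN.
  by rewrite coefD coefZ coefXn ltn_eqF // mulr0 addr0.
rewrite derivD derivZ derivXn mulrDl coefD opprD /psum coefN; congr (_ - _).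
rewrite -scalerAl mulrnAl coefZ coefMn coefXnM ltnn subnn truncinv_coef0 //.
by rewrite mulrnAr mulr1.
Qed.

(** Second order expansion of - X d/dX log (1 + w): when 2k >= n the inverse of
    1 + w modulo X^n is 1 - w, and the quadratic term w' w has a coefficient of
    degree n - 1 only if n = 2k, namely k w_k^2. *)
Lemma psum_1D n k (w : {poly R}) : (0 < n)%N -> (0 < k)%N -> (forall i, (i < k)%N -> w`_i = 0) ->
  (n <= k.*2)%N ->
  psum n (1 + w) = (if (n == k.*2)%N then w`_k ^+ 2 *+ k else 0) - w`_n *+ n.
Proof.
move=> n0 k0 wlt nk; have ltn1 : (n.-1 < n)%N by rewrite prednK.
have w0 : (1 + w)`_0 = 1 by rewrite coefD coef1 wlt // addr0.
rewrite (@psum_inv _ _ (1 - w)) //; last first.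
  move=> i iN; have -> : (1 + w) * (1 - w) = 1 - w * w by ring.
  rewrite coefB [X in _ - X](_ : _ = 0) ?subr0 // coefM big1 // => j _.
  have [jk|kj] := ltnP j k; first by rewrite wlt // mul0r.
  rewrite [w`_(_ - _)]wlt ?mulr0 //.
  by rewrite ltn_subLR -1?ltnS //; apply: leq_trans (leq_trans iN nk) _;
    rewrite -addnn leq_add2r.
rewrite derivD derivC add0r mulrBr mulr1 coefB opprB coef_deriv prednK //.
congr (_ - _); rewrite coefM prednK //.
have [nE|nne] := eqVneq n k.*2; last first.
  rewrite big1 // => j _; rewrite coef_deriv.
  have [jk|kj] := ltnP j.+1 k; first by rewrite wlt // mul0rn mul0r.
  rewrite [w`_(_ - _)]wlt ?mulr0 //.
  have ltnk : (n < k.*2)%N by rewrite ltn_neqAle nne.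
  lia.
have ltk : (k.-1 < n)%N by rewrite nE -addnn prednK // leq_addr.
rewrite (bigD1 (Ordinal ltk)) //= big1 ?addr0 => [|j neq].
  rewrite coef_deriv prednK // expr2 mulrnAl.
  by congr (_ * w`__ *+ _); rewrite nE -addnn -!subn1; lia.
rewrite coef_deriv; have [jk|kj] := ltnP j.+1 k; first by rewrite wlt // mul0rn mul0r.
rewrite [w`_(_ - _)]wlt ?mulr0 //; move: neq; rewrite -val_eqE /= => neq.
have := ltn_ord j; lia.
Qed.

(** First order variation in the direction X^(n - j).  Write u + c X^(n - j) as
    u (1 + w) with w = c X^(n - j) / u; since 2j < n, psum n (1 + w) is linear
    in w, equal to - n w_n, and w_n is c times the coefficient - u_j of X^j in
    1 / u. *)
Lemma psum_addX n j u (c : R) : (0 < j)%N -> (j.*2 < n)%N -> u`_0 = 1 ->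
  (forall i, (0 < i < j)%N -> u`_i = 0) ->
  psum n (u + c *: 'X^(n - j)) = psum n u + (c * u`_j) *+ n.
Proof.
move=> j0 jn u0 ulow; have n0 : (0 < n)%N by lia.
pose v := truncinv n.+1 u.
have vK : eq_modX n.+1 (u * v) 1 by exact: truncinvK.
have v0 : v`_0 = 1 by exact: truncinv_coef0.
pose w := (c *: 'X^(n - j)) * v.
have wE i : w`_i = if (i < n - j)%N then 0 else c * v`_(i - (n - j)).
  by rewrite /w -scalerAl coefZ coefXnM; case: ifP; rewrite ?mulr0.
have wlt i : (i < n - j)%N -> w`_i = 0 by rewrite wE => ->.
have w0 : (1 + w)`_0 = 1 by rewrite coefD coef1 wlt ?addr0 //; lia.
have s0 : (u + c *: 'X^(n - j))`_0 = 1.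
  rewrite coefD coefZ coefXn u0; have -> : (0 == n - j)%N = false by lia.
  by rewrite mulr0 addr0.
rewrite (@psum_ext n _ (u * (1 + w))) //; last first.
  have -> : u * (1 + w) = u + (c *: 'X^(n - j)) * (u * v) by rewrite /w; ring.
  move=> i iN; rewrite !coefD; congr (_ + _).
  by rewrite -[in LHS](mulr1 (c *: _)); apply/esym; exact: (eq_modXM (fun _ _ => erefl) vK).
rewrite psumM // (@psum_1D n (n - j)) //; try lia.
have -> : (n == (n - j).*2)%N = false by lia.
rewrite sub0r wE ifF; last lia.
have -> : (n - (n - j) = j)%N by lia.
suff -> : v`_j = - u`_j by rewrite mulrN mulNrn opprK.
have := vK j; rewrite coef1 gtn_eqF // => /(_ ltac:(lia)).
case: j j0 jn ulow {w wE wlt w0 s0} => // j _ jn ulow.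
rewrite coefM big_ord_recl big_ord_recr /= subn0 u0 mul1r subnn v0 mulr1.
rewrite big1 ?add0r => [|i _]; last by rewrite ulow ?mul0r //= /bump /=; have := ltn_ord i; lia.
by move/eqP; rewrite addr_eq0 => /eqP.
Qed.

Lemma psum_1subX n (a : R) : (0 < n)%N -> psum n (1 - a *: 'X) = a ^+ n.
Proof.
move=> n0; have ltn1 : (n.-1 < n)%N by rewrite prednK.
rewrite (@psum_inv _ _ (\poly_(i < n) a ^+ i)) //; first last.
- move=> i iN; rewrite mulrBl mul1r -scalerAl mulrC coefB coefZ coefMX !coef_poly iN coef1.
  case: i iN => [|i] iN /=; first by rewrite mulr0 subr0 expr0.
  by rewrite (ltnW iN) exprS subrr.
- by rewrite coefB coef1 coefZ coefX mulr0 subr0.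
rewrite derivB derivC derivZ derivX sub0r mulNr coefN opprK -scalerAl mul1r coefZ.
by rewrite coef_poly ltn1 -exprS prednK.
Qed.
End Truncation.

Lemma psum_map (R R' : comNzRingType) (f : {rmorphism R -> R'}) n (u : {poly R}) :
  psum n (map_poly f u) = f (psum n u).
Proof.
have truncinv_map : map_poly f (truncinv n u) = truncinv n (map_poly f u).
  by rewrite /truncinv rmorph_sum; apply: eq_bigr => i _; rewrite /= rmorphXn rmorphB rmorph1.
by rewrite /psum -coef_map rmorphN rmorphM /= -deriv_map truncinv_map.
Qed.

(** * Duality for the characters of a finite field *)
Lemma closed_prim_root (C : numClosedFieldType) n : (0 < n)%N ->
  exists z : C, n.-primitive_root z.
Proof.
move=> n0; pose p : {poly C} := 'X^n - 1.
have [rs pE] := closed_field_poly_normal p.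
have lp : lead_coef p = 1 by exact: (lead_coefXnsubC 1 n0).
rewrite lp scale1r in pE.
have us : uniq rs.
  rewrite -separable_prod_XsubC -pE.
  by rewrite separable_Xn_sub_1 // pnatr_eq0 -lt0n.
have sz : size rs = n.
  have : size p = n.+1 by exact: (size_XnsubC 1 n0).
  by rewrite pE size_prod_XsubC; case.
have /hasP[z _ zP] : has n.-primitive_root rs.
  apply: has_prim_root => //; last by rewrite sz.
  apply/allP => z; rewrite -root_prod_XsubC -pE /p rootE !hornerE subr_eq0.
  by rewrite unity_rootE.
by exists z.
Qed.

Section CharFacts.
Context (C : fieldType) (K : finFieldType).
Implicit Types (c eta chi : mulchar C K) (x y : {unit K}).

Lemma mulchar_mulE c chi x : (c * chi)%g x = c x * chi x.
Proof. by rewrite /= ffunE. Qed.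

Lemma mulchar_oneE x : (1%g : mulchar C K) x = 1.
Proof. by rewrite /= ffunE. Qed.

Lemma mulchar_invE c x : (c^-1)%g x = (c x)^-1.
Proof. by rewrite /= ffunE. Qed.

Lemma mulchar_expE c n x : (c ^+ n)%g x = c x ^+ n.
Proof.
by elim: n => [|n IH]; rewrite ?expg0 ?mulchar_oneE // expgS exprS mulchar_mulE IH.
Qed.

Lemma mulchar_commute c chi : (c * chi = chi * c)%g.
Proof. by apply: mulcharPext => x; rewrite !mulchar_mulE mulrC. Qed.

Lemma mulcharV c x : c (x^-1)%g = (c x)^-1.
Proof. by apply: (mulIf (mulchar_neq0 c x)); rewrite -mulcharM !mulVg mulVf ?mulchar_neq0 ?mulchar1. Qed.

Lemma mulcharX c n x : c (x ^+ n)%g = c x ^+ n.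
Proof.
by elim: n => [|n IH]; rewrite ?expg0 ?mulchar1 // expgS exprS mulcharM IH.
Qed.

Lemma mulchar_neq1 c : c != 1%g -> exists x, c x != 1.
Proof.
move=> c1; apply/existsP; apply: contraNT c1 => /existsPn cE.
by apply/eqP/mulcharPext => x; rewrite mulchar_oneE; apply/eqP; have := cE x; rewrite negbK.
Qed.

Lemma sum_mulchar_neq1 c : c != 1%g -> \sum_x c x = 0.
Proof.
move=> /mulchar_neq1[y cy]; apply/eqP; rewrite -[_ == 0]orFb -(negbTE cy) -subr_eq0 -mulf_eq0.
rewrite mulrBl mul1r subr_eq0 mulr_sumr [X in _ == X](reindex_inj (mulgI y)) /=.
by apply/eqP/eq_bigr => x _; rewrite mulcharM.
Qed.

End CharFacts.

Section Dual.
Context (C : numClosedFieldType) (K : finFieldType).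
Local Notation M := #|{: {unit K}}|.

(** The units are cyclic, so a character is determined by an arbitrary root of
    unity of the right order chosen as the image of a generator. *)
Lemma faithful_mulchar : exists g (c : mulchar C K),
  [/\ forall x, exists i, x = (g ^+ i)%g & M.-primitive_root (c g)].
Proof.
have /cyclicP[g gE] := field_unit_group_cyclic [set: {unit K}].
have gen x : exists i, x = (g ^+ i)%g by apply/cycleP; rewrite -gE inE.
have og : #[g]%g = M by rewrite orderE -gE cardsT.
have M0 : (0 < M)%N by rewrite -og order_gt0.
have [z zP] := closed_prim_root C M0.
pose lg x : nat := odflt (Ordinal M0) [pick i : 'I_M | (g ^+ i)%g == x].
have lgP x : (g ^+ lg x)%g = x.
  rewrite /lg; case: pickP => [i /eqP//|no].
  have [i xE] := gen x.
  by have := no (Ordinal (ltn_pmod i M0)); rewrite /= xE -og expg_mod_order eqxx.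
have zE i j : (g ^+ i)%g = (g ^+ j)%g -> z ^+ i = z ^+ j.
  by move/eqP; rewrite eq_expg_mod_order og => /eqP ij; apply/eqP; rewrite (eq_prim_root_expr zP); apply/eqP.
have cP : is_mulchar [ffun x => z ^+ lg x].
  apply/is_mulcharP; split=> [|x y]; rewrite !ffunE.
    by rewrite -(expr0 z); apply: zE; rewrite lgP expg0.
  by rewrite -exprD; apply: zE; rewrite expgD !lgP.
exists g, (MulChar cP); split=> //; rewrite /= ffunE.
by rewrite (zE _ 1%N) ?expr1 // lgP expg1.
Qed.

Lemma mulchar_enum_ex : exists s : seq (mulchar C K),
  [/\ uniq s, forall c, c \in s & size s = M].
Proof.
have [g [c [gen cP]]] := faithful_mulchar.
exists [seq (c ^+ i)%g | i <- iota 0 M]; split; last by rewrite size_map size_iota.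
  rewrite map_inj_in_uniq ?iota_uniq // => i j; rewrite !mem_iota /= !add0n => iM jM.
  move=> /(congr1 (fun f : mulchar C K => f g)); rewrite !mulchar_expE => /eqP.
  by rewrite (eq_prim_root_expr cP) !modn_small // => /eqP.
move=> f; have fg : f g ^+ M = 1.
  rewrite -mulcharX -(mulchar1 f); congr (f _).
  by have := expg_cardG (in_setT g); rewrite cardsT.
have [i iE] := prim_rootP cP fg.
apply/mapP; exists (i : nat); first by rewrite mem_iota /= add0n.
apply: mulcharPext => x; have [j ->] := gen x.
by rewrite mulchar_expE !mulcharX iE -!exprM mulnC.
Qed.

Definition mulchar_enum := sval (cid mulchar_enum_ex).

Lemma mem_mulchar_enum c : c \in mulchar_enum.
Proof. by rewrite /mulchar_enum; case: cid => s []. Qed.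

Lemma mulchar_enumP : Finite.axiom mulchar_enum.
Proof.
move=> c; rewrite count_uniq_mem ?mem_mulchar_enum //.
by rewrite /mulchar_enum; case: cid => s [].
Qed.

Lemma mulchar_indexK : cancel (fun c => index c mulchar_enum) (nth 1%g mulchar_enum).
Proof. by move=> c; rewrite nth_index ?mem_mulchar_enum. Qed.

(* Characters form a finite type, so that sums over characters are ordinary
   iterated sums which can be reindexed by translations. *)
HB.instance Definition _ := Countable.copy (mulchar C K) (can_type mulchar_indexK).
HB.instance Definition _ := isFinite.Build (mulchar C K) mulchar_enumP.

Lemma card_mulchar : #|{: mulchar C K}| = M.
Proof.
by rewrite cardT enumT unlock /= /mulchar_enum; case: cid => s [].
Qed.

Lemma sum_mulchar_dual (x : {unit K}) : x != 1%g -> \sum_(c : mulchar C K) c x = 0.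
Proof.
move=> x1; have [c cx] : exists c : mulchar C K, c x != 1.
  have [g [c [gen cP]]] := faithful_mulchar; exists c.
  apply: contraNneq x1 => cx; have [i iE] := gen x.
  move: cx; rewrite iE mulcharX => /eqP; rewrite -(prim_order_dvd cP) => /dvdnP[k ->].
  by rewrite mulnC expgM; have := expg_cardG (in_setT g); rewrite cardsT => ->; rewrite expg1n.
apply/eqP; rewrite -[_ == 0]orFb -(negbTE cx) -subr_eq0 -mulf_eq0.
rewrite mulrBl mul1r subr_eq0 mulr_sumr [X in _ == X](reindex_inj (mulgI c)) /=.
by apply/eqP/eq_bigr => f _; rewrite mulchar_mulE.
Qed.

(** Both sides, multiplied by the order of the group, equal the double sum over
    x and c of eta(x) c(y) c(x)^(-n), by the two orthogonality relations. *)
Lemma sum_mulchar_root (eta : mulchar C K) n (y : {unit K}) :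
  \sum_(c : mulchar C K | (c ^+ n)%g == eta) c y = \sum_(x | (x ^+ n)%g == y) eta x.
Proof.
have M0 : M%:R != 0 :> C.
  by rewrite pnatr_eq0 -lt0n; apply/card_gt0P; exists 1%g.
apply: (mulfI M0).
have orth (c : mulchar C K) : \sum_x (eta * (c ^+ n)^-1)%g x = M%:R * ((c ^+ n)%g == eta)%:R.
  have [->|ne] := eqVneq (c ^+ n)%g eta.
    rewrite mulgV mulr1 (eq_bigr (fun=> 1)) => [|x _]; last by rewrite mulchar_oneE.
    by rewrite sumr_const.
  rewrite mulr0; apply: sum_mulchar_neq1; rewrite -eq_mulgV1 eq_sym //.
have orth' x : \sum_(c : mulchar C K) c (y * (x ^+ n)^-1)%g = M%:R * ((x ^+ n)%g == y)%:R.
  have [->|ne] := eqVneq (x ^+ n)%g y.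
    rewrite mulgV mulr1 (eq_bigr (fun=> 1)) => [|c _]; last by rewrite mulchar1.
    by rewrite sumr_const -card_mulchar.
  by rewrite mulr0; apply: sum_mulchar_dual; rewrite -eq_mulgV1 eq_sym.
rewrite !mulr_sumr big_mkcond [RHS]big_mkcond /=.
transitivity (\sum_(c : mulchar C K) \sum_x c y * (eta * (c ^+ n)^-1)%g x).
  apply: eq_bigr => c _; rewrite -mulr_sumr orth mulrCA.
  by case: ifP; rewrite ?mulr0 ?mulr1 // !mulr0.
rewrite exchange_big; apply: eq_bigr => x _.
transitivity (eta x * \sum_(c : mulchar C K) c (y * (x ^+ n)^-1)%g).
  rewrite mulr_sumr; apply: eq_bigr => c _.
  by rewrite mulchar_mulE mulchar_invE mulchar_expE mulcharM mulcharV mulcharX mulrCA.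
by rewrite orth' mulrCA; case: ifP; rewrite ?mulr0 ?mulr1 // !mulr0.
Qed.

Lemma sum_gauss_root (psi : K -> C) (eta : mulchar C K) n :
  \sum_(c : mulchar C K | (c ^+ n)%g == eta) gauss psi c
  = \sum_(x : {unit K}) eta x * psi (val x ^+ n).
Proof.
rewrite /gauss exchange_big /=.
under eq_bigr do rewrite -mulr_suml sum_mulchar_root mulr_suml.
rewrite (exchange_big_dep xpredT) //=; apply: eq_bigr => x _.
rewrite (big_pred1 (x ^+ n)%g) => [|y]; last by rewrite eq_sym.
by rewrite FinRing.val_unitX.
Qed.
End Dual.

(** * Gauss sums *)
Section Gauss.
Context (C : numClosedFieldType) (K : finFieldType) (psi : K -> C).
Context (psi_char : additive_character psi).
Context (psi_nontrivial : nontrivial_character psi).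
Implicit Types (c chi eta : mulchar C K).

Definition char_ext0 chi (x : K) : C := if x == 0 then 0 else chi (to_unit x).

Lemma to_unitK (x : K) : x != 0 -> val (to_unit x) = x.
Proof. by move=> x0; rewrite /to_unit insubdK // -topredE /= unitfE. Qed.

Lemma unit_neq0 (u : {unit K}) : val u != 0.
Proof. by have := valP u; rewrite unitfE. Qed.

Lemma valK_unit (u : {unit K}) : to_unit (val u) = u.
Proof. by apply: val_inj; rewrite to_unitK ?unit_neq0. Qed.

Lemma char_ext0_unit chi (u : {unit K}) : char_ext0 chi (val u) = chi u.
Proof. by rewrite /char_ext0 (negbTE (unit_neq0 u)) valK_unit. Qed.

Lemma char_ext0_0 chi : char_ext0 chi 0 = 0. Proof. by rewrite /char_ext0 eqxx. Qed.

Lemma char_ext0M chi : {morph char_ext0 chi : x y / x * y}.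
Proof.
move=> x y; rewrite /char_ext0 mulf_eq0.
have [->|x0] := eqVneq x 0; first by rewrite /= mul0r.
have [->|y0] := eqVneq y 0; first by rewrite /= mulr0.
rewrite -mulcharM; congr (chi _); apply: val_inj.
by rewrite FinRing.val_unitM !to_unitK ?mulf_neq0.
Qed.

Lemma char_ext0_1 chi : char_ext0 chi 1 = 1.
Proof. by rewrite -(FinRing.val_unit1 K) char_ext0_unit mulchar1. Qed.

Lemma char_ext0X chi n x : char_ext0 chi (x ^+ n) = char_ext0 chi x ^+ n.
Proof. by elim: n => [|n IH]; rewrite ?expr0 ?char_ext0_1 // !exprS char_ext0M IH. Qed.

Lemma char_ext0_neq0 chi x : x != 0 -> char_ext0 chi x != 0.
Proof. by move=> x0; rewrite /char_ext0 (negbTE x0) mulchar_neq0. Qed.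

Lemma char_ext0V chi x : char_ext0 chi x^-1 = (char_ext0 chi x)^-1.
Proof.
have [->|x0] := eqVneq x 0; first by rewrite invr0 char_ext0_0 invr0.
by apply: (mulIf (char_ext0_neq0 chi x0)); rewrite -char_ext0M !mulVf ?char_ext0_neq0 ?char_ext0_1.
Qed.

Lemma sum_unit (f : K -> C) : \sum_(u : {unit K}) f (val u) = \sum_(x | x != 0) f x.
Proof.
rewrite (reindex_onto val (@to_unit K)) => [|x]; last exact: to_unitK.
by apply: eq_bigl => u; rewrite unit_neq0 valK_unit eqxx.
Qed.

Lemma gaussE chi : gauss psi chi = \sum_x char_ext0 chi x * psi x.
Proof.
rewrite /gauss; under eq_bigr do rewrite -char_ext0_unit.
rewrite (sum_unit (fun x => char_ext0 chi x * psi x)) big_mkcond; apply: eq_bigr => x _.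
by case: eqVneq => // ->; rewrite char_ext0_0 mul0r.
Qed.

Lemma gauss_scale chi a : a != 0 ->
  \sum_x char_ext0 chi x * psi (a * x) = (char_ext0 chi a)^-1 * gauss psi chi.
Proof.
move=> a0; rewrite gaussE mulr_sumr [RHS](reindex_inj (mulfI a0)) /=.
apply: eq_bigr => x _; rewrite mulrA char_ext0M mulKf // char_ext0_neq0 //.
Qed.

Lemma psiD x y : psi (x + y) = psi x * psi y. Proof. by case: psi_char. Qed.
Lemma psi_0 : psi 0 = 1. Proof. by case: psi_char. Qed.

Lemma psiN x : psi (- x) = (psi x)^-1.
Proof.
have E : psi x * psi (- x) = 1 by rewrite -psiD subrr psi_0.
have x0 : psi x != 0 by apply: contra_eqN E => /eqP ->; rewrite mul0r eq_sym oner_eq0.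
by apply: (mulfI x0); rewrite E mulfV.
Qed.

Lemma sum_psi : \sum_x psi x = 0.
Proof.
have [y /eqP py] := psi_nontrivial; apply/eqP.
rewrite -[_ == 0]orFb -(negbTE py) -subr_eq0 -mulf_eq0.
rewrite mulrBl mul1r subr_eq0 mulr_sumr [X in _ == X](reindex_inj (addrI y)) /=.
by apply/eqP/eq_bigr => x _; rewrite psiD.
Qed.

Lemma sum_psi_scale a : \sum_x psi (a * x) = if a == 0 then #|K|%:R else 0.
Proof.
have [->|a0] := eqVneq a 0.
  by rewrite (eq_bigr (fun=> 1)) ?sumr_const // => x _; rewrite mul0r psi_0.
by rewrite -[RHS]sum_psi [RHS](reindex_inj (mulfI a0)).
Qed.

Lemma gauss_one : gauss psi 1%g = -1.
Proof.
rewrite /gauss; under eq_bigr do rewrite mulchar_oneE mul1r.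
by have /eqP := sum_psi; rewrite (bigD1 0) //= psi_0 addrC addr_eq0 sum_unit => /eqP.
Qed.

(** Put u = v w in the double sum over u and v: the sum over v of
    psi(v (w + 1)) is q - 1 for w = -1 and -1 otherwise. *)
Lemma gaussV chi : chi != 1%g ->
  gauss psi chi * gauss psi chi^-1%g = char_ext0 chi (-1) * #|K|%:R.
Proof.
move=> chi1; rewrite {1}/gauss mulr_suml.
transitivity (\sum_(u : {unit K}) \sum_(w : {unit K}) chi w * psi (val u * (val w + 1))).
  rewrite [RHS]exchange_big /=.
  transitivity (\sum_(v : {unit K}) \sum_(u : {unit K}) chi u * psi (val u) * (chi^-1%g v * psi (val v))).
    by rewrite exchange_big; apply: eq_bigr => u _; rewrite /gauss mulr_sumr.
  rewrite [RHS]exchange_big; apply: eq_bigr => v _; rewrite (reindex_inj (mulgI v)) /=.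
  apply: eq_bigr => w _; rewrite mulcharM mulchar_invE mulrDr mulr1 psiD /=.
  by have := mulchar_neq0 chi v => v0; field.
rewrite exchange_big /=.
have inner (w : {unit K}) : \sum_(u : {unit K}) psi (val u * (val w + 1)) =
    (if val w == -1 then #|K|%:R else 0) - 1.
  rewrite (sum_unit (fun x => psi (x * (val w + 1)))) -addr_eq0.
  under eq_bigr do rewrite mulrC.
  rewrite -sum_psi_scale [in RHS](bigD1 0) //= mulr0 psi_0; ring.
under eq_bigr do rewrite -mulr_sumr inner mulrBr mulr1.
rewrite sumrB sum_mulchar_neq1 // subr0.
have -> : (-1 : K) = val (to_unit (-1 : K)) by rewrite to_unitK // oppr_eq0 oner_eq0.
rewrite char_ext0_unit (bigD1 (to_unit (-1 : K))) //= eqxx big1 ?addr0 // => w wne.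
by rewrite ifN ?mulr0.
Qed.

Lemma gauss_neq0 chi : gauss psi chi != 0.
Proof.
have [->|chi1] := eqVneq chi 1%g; first by rewrite gauss_one oppr_eq0 oner_eq0.
have q0 : #|K|%:R != 0 :> C by rewrite pnatr_eq0 -lt0n; apply/card_gt0P; exists 0.
have : gauss psi chi * gauss psi chi^-1%g != 0.
  by rewrite gaussV // mulf_neq0 // char_ext0_neq0 // oppr_eq0 oner_eq0.
by rewrite mulf_eq0 negb_or => /andP[].
Qed.

(** The product of the sums for a and - a is q: substituting x + y for y
    turns a (y^2 - x^2) into a y^2 + 2 a x y, linear in x. *)
Lemma quadratic_gauss_neq0 (a : K) : a *+ 2 != 0 -> \sum_x psi (a * x ^+ 2) != 0.
Proof.
move=> a2; pose g b := \sum_x psi (b * x ^+ 2).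
suff : g a * g (- a) = #|K|%:R.
  move=> E; apply/eqP => g0; move: E; rewrite [g a]g0 mul0r => /esym/eqP.
  by rewrite pnatr_eq0 -leqn0 leqNgt => /negP; apply; apply/card_gt0P; exists 0.
rewrite /g mulr_suml.
(* Substitute x + y for y, then sum over x first. *)
transitivity (\sum_x \sum_y psi (a * (y ^+ 2)) * psi ((a *+ 2 * y) * x)).
  transitivity (\sum_x \sum_y psi (a * y ^+ 2) * psi (- a * x ^+ 2)).
    by rewrite exchange_big; apply: eq_bigr => x _; rewrite mulr_sumr.
  apply: eq_bigr => x _; rewrite (reindex_inj (addIr x)) /=.
  by apply: eq_bigr => y _; rewrite -!psiD; congr psi; rewrite -mulr_natr; ring.
rewrite exchange_big /= (bigD1 0) //= [X in _ + X]big1 ?addr0 => [|y y0].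
  rewrite -mulr_sumr sum_psi_scale mulr0 eqxx expr0n /= mulr0 psi_0 mul1r //.
by rewrite -mulr_sumr sum_psi_scale mulf_eq0 (negbTE a2) (negbTE y0) mulr0.
Qed.
End Gauss.

(** * Coefficients of the L-function *)
Lemma coef_addXn (R : nzRingType) (u : {poly R}) (x : R) k i :
  (u + x *: 'X^k)`_i = u`_i + x * (i == k)%:R.
Proof. by rewrite coefD coefZ coefXn. Qed.

Section UnitPoly.
Context (F : comNzRingType).

(** The polynomials u with u(0) = 1 and degree at most m, parametrized by their
    other coefficients, so that they can be summed over a finite type. *)
Definition upoly m (c : 'rV[F]_m) : {poly F} := 1 + rVpoly c * 'X.

Definition shiftv m k (x : F) : 'rV[F]_m := \row_j (x * (j.+1 == k)%:R).

Lemma coef_upoly m (c : 'rV[F]_m) k :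
  (upoly c)`_k = if k is k'.+1 then (rVpoly c)`_k' else 1.
Proof. by rewrite coefD coef1 coefMX; case: k => [|k]; rewrite ?addr0 ?add0r. Qed.

Lemma upoly0 m (c : 'rV[F]_m) : (upoly c)`_0 = 1.
Proof. by rewrite coef_upoly. Qed.

Lemma size_upoly m (c : 'rV[F]_m) : (size (upoly c) <= m.+1)%N.
Proof.
apply/leq_sizeP => -[//|j]; rewrite ltnS coef_upoly => mj.
by apply/leq_sizeP: mj; exact: size_poly.
Qed.

Lemma upoly_shift m k (x : F) (c : 'rV[F]_m) : (0 < k <= m)%N ->
  upoly (c + shiftv m k x) = upoly c + x *: 'X^k.
Proof.
move=> /andP[]; case: k => // k _ km; rewrite /upoly linearD /= mulrDl addrA; congr (_ + _).
rewrite exprSr scalerAl; congr (_ * _); apply/polyP => i; rewrite coefZ coefXn.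
rewrite coef_rVpoly; case: insubP => [j _ <-|]; first by rewrite mxE eqSS.
by rewrite -leqNgt => mi; rewrite gtn_eqF ?mulr0 //; apply: leq_trans mi.
Qed.

Lemma shiftv_inj m k x : injective (fun c : 'rV[F]_m => c + shiftv m k x).
Proof. exact: addIr. Qed.

Lemma upolyK m (u : {poly F}) : u`_0 = 1 -> (size u <= m.+1)%N ->
  exists c : 'rV[F]_m, upoly c = u.
Proof.
move=> u0 su; exists (\row_(i < m) u`_i.+1); apply/polyP => -[|k]; rewrite coef_upoly //.
rewrite coef_rVpoly; case: insubP => [j _ <-|]; first by rewrite mxE.
by rewrite -leqNgt => mk; rewrite nth_default //; apply: leq_trans su _.
Qed.

Lemma upoly_inj m : injective (@upoly m).
Proof.
move=> c d E; apply/rowP => i.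
by have := congr1 (fun p : {poly F} => p`_i.+1) E; rewrite !coef_upoly !coef_rVpoly_ord.
Qed.
End UnitPoly.

Section LFun.
Context (C : numClosedFieldType) (F : finFieldType) (psi : F -> C).
Context (psi_char : additive_character psi).
Context (psi_nontrivial : nontrivial_character psi).
Context (n : nat).
Context (nF : n%:R != 0 :> F).

Let n_gt0 : (0 < n)%N. Proof. by case: n nF => //; rewrite eqxx. Qed.

Section Char.
Context (eta : mulchar C F).

(** The value Lambda(u) for u of degree m.  Extending eta by zero discards the
    polynomials of degree less than m from the sum Lcoef below; the sign makes
    the argument of eta the product of the inverse roots of u. *)
Definition Lterm m (u : {poly F}) := char_ext0 eta ((-1) ^+ m * u`_m) * psi (psum n u).
Definition Lcoef m := \sum_(c : 'rV[F]_m) Lterm m (upoly c).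

Lemma psi_shift x (u : {poly F}) : u`_0 = 1 ->
  psi (psum n (u + x *: 'X^n)) = psi (psum n u) * psi (- n%:R * x).
Proof. by move=> u0; rewrite psum_addXn // psiD // mulNr mulr_natl. Qed.

(** Adding x X^n to u multiplies each term by psi(- n x) and leaves the
    coefficient of index m > n unchanged, so Lcoef m is invariant under
    multiplication by some psi y different from 1. *)
Lemma Lcoef_gt m : (n < m)%N -> Lcoef m = 0.
Proof.
move=> nm; have [y /eqP y1] := psi_nontrivial.
(* x is chosen so that psi (- n x) = psi y differs from 1. *)
pose x := - n%:R^-1 * y.
have xE : psi (- n%:R * x) = psi y by rewrite /x mulrA mulrNN mulfV // mul1r.
suff E : Lcoef m * psi y = Lcoef m.
  by move/eqP: E; rewrite -subr_eq0 -{2}[Lcoef m]mulr1 -mulrBr mulf_eq0 subr_eq0 (negbTE y1) orbF => /eqP.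
rewrite {2}/Lcoef (reindex_inj (@shiftv_inj _ m n x)) /Lcoef mulr_suml; apply: eq_bigr => c _.
rewrite upoly_shift ?n_gt0 ?(ltnW nm) // /Lterm psi_shift ?upoly0 // xE.
by rewrite coef_addXn gtn_eqF // mulr0 addr0 mulrA.
Qed.

Lemma Lcoef0 : Lcoef 0 = 1.
Proof.
rewrite /Lcoef (big_pred1 0) => [|c]; last by rewrite [c]thinmx0 /= eqxx.
rewrite /Lterm expr0 mul1r coef_upoly char_ext0_1 mul1r.
have -> : upoly (0 : 'rV[F]_0) = 1 by rewrite /upoly linear0 mul0r addr0.
by rewrite /psum derivC mul0r oppr0 coef0 psi_0.
Qed.
End Char.

Definition Lconst := \sum_(c : 'rV[F]_n | (upoly c)`_n == 0) psi (psum n (upoly c)).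

(** Fibre the sum over the coefficient x of X^n: by psum_addXn the fibre over x
    is psi(- n x) times the fibre over 0, which does not involve eta. *)
Lemma Lcoef_top eta : Lcoef eta n =
  Lconst * ((char_ext0 eta ((-1) ^+ n.-1 * n%:R))^-1 * gauss psi eta).
Proof.
have n0 : - n%:R != 0 :> F by rewrite oppr_eq0.
rewrite /Lcoef (partition_big (fun c => (upoly c)`_n) xpredT) //=.
transitivity (\sum_x char_ext0 eta ((-1) ^+ n) * (Lconst * (char_ext0 eta x * psi (- n%:R * x)))).
  apply: eq_bigr => x _; rewrite (reindex_inj (@shiftv_inj _ n n x)) /Lconst.
  rewrite mulr_suml mulr_sumr; apply: eq_big => c; rewrite upoly_shift ?n_gt0 //=.
    by rewrite coef_addXn eqxx mulr1 -subr_eq0 addrK.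
  rewrite coef_addXn eqxx mulr1 => /eqP cx.
  have c0 : (upoly c)`_n = 0 by apply: (addIr x); rewrite add0r.
  rewrite /Lterm psi_shift ?upoly0 // coef_addXn eqxx mulr1 c0 add0r char_ext0M.
  by rewrite -!mulrA; congr (_ * _); rewrite mulrCA.
rewrite -!mulr_sumr gauss_scale // mulrCA; congr (_ * _); rewrite mulrA; congr (_ * _).
apply: (mulIf (char_ext0_neq0 eta n0)).
rewrite mulfVK ?char_ext0_neq0 // -char_ext0V -char_ext0M; congr char_ext0.
have s0 : (-1) ^+ n.-1 != 0 :> F by rewrite expf_neq0 // oppr_eq0 oner_eq0.
rewrite invfM mulrN mulrVK ?unitfE //.
by rewrite -{1}(prednK n_gt0) exprS mulN1r -exprVn invrN invr1.
Qed.

Section Stationary.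

Let low j (c : 'rV[F]_n) :=
  ((upoly c)`_n == 0) && [forall i : 'I_j, (0 < i)%N ==> ((upoly c)`_i == 0)].

Let lowsum j := \sum_(c | low j c) psi (psum n (upoly c)).

Lemma lowP j c : reflect ((upoly c)`_n = 0 /\ forall i, (0 < i < j)%N -> (upoly c)`_i = 0)
   (low j c).
Proof.
apply: (iffP andP) => [[/eqP -> /forallP h]|[-> h]]; split=> //.
  by move=> i /andP[i0 ij]; apply/eqP; exact: (implyP (h (Ordinal ij))).
by apply/forallP => i; apply/implyP => i0; rewrite h // i0 ltn_ord.
Qed.

Lemma low_shift j k x c : (0 < j <= k)%N -> (k < n)%N ->
  low j (c + shiftv n k x) = low j c.
Proof.
move=> jk kn; have k0 : (0 < k <= n)%N by lia.
have E i : (i < j)%N || (i == n) -> (upoly (c + shiftv n k x))`_i = (upoly c)`_i.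
  move=> ij; rewrite upoly_shift // coef_addXn.
  by rewrite (_ : (i == k) = false) ?mulr0 ?addr0 //; lia.
congr (_ && _); first by rewrite E ?eqxx ?orbT.
by apply: eq_forallb => i; rewrite E ?ltn_ord.
Qed.

(** Averaging over the translations of u by x X^(n - j) multiplies the term of u
    by the mean of psi(n u_j x), which is the indicator of u_j = 0. *)
Lemma lowsum_step j : (0 < j)%N -> (j.*2 < n)%N -> lowsum j = lowsum j.+1.
Proof.
move=> j0 jn; have q0 : #|F|%:R != 0 :> C.
  by rewrite pnatr_eq0 -lt0n; apply/card_gt0P; exists 0.
apply: (mulfI q0).
transitivity (\sum_(x : F) lowsum j); first by rewrite sumr_const mulr_natl.
transitivity (\sum_(c | low j c) psi (psum n (upoly c)) * \sum_x psi (n%:R * (upoly c)`_j * x)).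
  under [RHS]eq_bigr do rewrite mulr_sumr.
  rewrite [RHS]exchange_big; apply: eq_bigr => x _.
  rewrite /lowsum (reindex_inj (@shiftv_inj _ n (n - j)%N x)); apply: eq_big => c.
    by rewrite low_shift //; lia.
  rewrite low_shift; try lia; move=> /lowP[_ clow].
  rewrite upoly_shift; last lia.
  rewrite psum_addX ?upoly0 // psiD //; congr (_ * psi _).
  by rewrite -mulr_natl -mulrA [x * _]mulrC.
under eq_bigr do rewrite sum_psi_scale // mulf_eq0 (negbTE nF) /=.
rewrite /lowsum mulr_sumr big_mkcond [RHS]big_mkcond; apply: eq_bigr => c _.
have -> : low j.+1 c = low j c && ((upoly c)`_j == 0).
  apply/lowP/andP => [[cn h]|[/lowP[cn h] /eqP hj]].
    split; last by rewrite h // j0 /=.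
    by apply/lowP; split=> // i /andP[i0 ij]; apply: h; rewrite i0 leqW.
  split=> // i /andP[i0]; rewrite ltnS leq_eqVlt => /predU1P[->//|ij].
  by apply: h; rewrite i0.
case: (low j c) => //=; case: ifP => _; first by rewrite mulrC.
by rewrite mulr0.
Qed.

(** After the steps j < n / 2, only the polynomials u with u_n = 0 and u_i = 0
    for 0 < i < j remain, where j is n / 2 rounded up.  On them psi (psum n u)
    is 1 if n is odd, and psi(j u_j^2) if n = 2j; the sum is then the
    number of terms, or a positive multiple of a quadratic Gauss sum. *)
Lemma Lconst_neq0 : Lconst != 0.
Proof.
have cE : Lconst = lowsum 1.
  apply: eq_bigl => c; apply/eqP/lowP => [cn|[]//]; split=> // i; lia.
have lowsumE j : (j.*2 < n)%N -> Lconst = lowsum j.+1.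
  elim: j => [//|j IH] jn; rewrite IH; last lia.
  by apply: lowsum_step; lia.
(* The reduction stops at j = uphalf n, the least j with n <= 2j. *)
pose J := (uphalf n).-1; pose j := J.+1.
have jE : j = uphalf n by rewrite /j /J prednK // uphalf_gt0.
rewrite (lowsumE J) -/j; last by move: (uphalf_half n) (odd_double_half n); lia.
have nj : (n <= j.*2)%N by rewrite jE; move: (uphalf_half n) (odd_double_half n); lia.
have psE c : low j c -> psi (psum n (upoly c)) =
    if n == j.*2 then psi (j%:R * (upoly c)`_j ^+ 2) else 1.
  move=> /lowP[cn clow]; rewrite /upoly (@psum_1D _ n j) //; last first.
    move=> i ij; rewrite coefMX; case: i ij => //= i ij.
    by have := clow i.+1; rewrite ij coef_upoly => ->.
  have -> : (rVpoly c * 'X)`_n = 0.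
    by move: cn; rewrite coef_upoly coefMX; move: (rVpoly c) => r; case: (n) n_gt0.
  rewrite mul0rn subr0 coefMX coefD coef1 add0r /=.
  by case: ifP => _; rewrite ?psi_0 // coefMX /= mulr_natl.
rewrite /lowsum (eq_bigr _ psE).
have low0 : low j 0.
  apply/lowP; rewrite /upoly linear0 mul0r addr0; split=> [|i ij].
    by rewrite coef1 gtn_eqF.
  by rewrite coef1 gtn_eqF //; case/andP: ij.
have [nE|nne] := eqVneq n j.*2; last first.
  rewrite sumr_const pnatr_eq0 -lt0n; apply/card_gt0P; exists 0.
  by rewrite unfold_in.
pose N := #|[pred c | low j c & (upoly c)`_j == 0]|.
have jn : (j < n)%N by rewrite nE /j; lia.
rewrite (partition_big (fun c => (upoly c)`_j) xpredT) //=.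
rewrite (eq_bigr (fun x => N%:R * psi (j%:R * x ^+ 2))) => [|x _].
  rewrite -mulr_sumr mulf_neq0 //.
    rewrite pnatr_eq0 -lt0n; apply/card_gt0P; exists 0.
    by rewrite inE low0 /upoly linear0 mul0r addr0 coef1 /j eqxx.
  apply: quadratic_gauss_neq0 => //.
  by rewrite -mulrnA muln2 -nE.
rewrite (eq_bigr (fun=> psi (j%:R * x ^+ 2))) => [|c /andP[_ /eqP ->] //].
rewrite (reindex_inj (@shiftv_inj _ n j x)) /= [RHS]mulr_natl -sumr_const.
apply: eq_bigl => c; rewrite low_shift ?leqnn //.
rewrite inE; congr (_ && _); rewrite upoly_shift; last lia.
by rewrite coef_addXn eqxx mulr1 -subr_eq0 addrK.
Qed.
End Stationary.
End LFun.

(** * Reciprocal characteristic polynomials *)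
Lemma big_iota0 (T : Type) (idx : T) (op : T -> T -> T) r (f : nat -> T) :
  \big[op/idx]_(i <- iota 0 r) f i = \big[op/idx]_(i < r) f i.
Proof. by rewrite -(big_mkord xpredT f) /index_iota subn0. Qed.

Section CoefTop.
Context (R : comNzRingType).
Implicit Types (u v : {poly R}).

Lemma coefM_top u v a b : (size u <= a.+1)%N -> (size v <= b.+1)%N ->
  (u * v)`_(a + b) = u`_a * v`_b.
Proof.
move=> su sv; rewrite coefM.
have lt : (a < (a + b).+1)%N by rewrite ltnS leq_addr.
rewrite (bigD1 (Ordinal lt)) //= addKn big1 ?addr0 // => i; rewrite -val_eqE /= => ia.
have [ai|ai] := ltnP a i; first by rewrite (nth_default _ (leq_trans su ai)) mul0r.
rewrite (nth_default _ (leq_trans sv _)) ?mulr0 //; lia.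
Qed.

Lemma psum_prod_1subX (I : Type) n (s : seq I) (a : I -> R) : (0 < n)%N ->
  (\prod_(i <- s) (1 - a i *: 'X))`_0 = 1 /\
  psum n (\prod_(i <- s) (1 - a i *: 'X)) = \sum_(i <- s) a i ^+ n.
Proof.
move=> n0; elim: s => [|i s [IH0 IH]].
  by rewrite !big_nil coef1 /psum derivC mul0r oppr0 coef0.
have c0 : (1 - a i *: 'X)`_0 = 1 by rewrite coefB coef1 coefZ coefX mulr0 subr0.
by rewrite !big_cons coef0M c0 IH0 mulr1 psumM // psum_1subX // IH.
Qed.

Lemma size_1subX (a : R) : (size (1 - a *: 'X : {poly R})%R <= 2)%N.
Proof.
apply/leq_sizeP => j j2; rewrite coefB coefZ coef1 coefX.
by rewrite gtn_eqF ?[j == 1%N]gtn_eqF ?mulr0 ?subr0 //; apply: ltn_trans j2.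
Qed.

Lemma prod_1subX_top (I : Type) (s : seq I) (a : I -> R) :
  (size (\prod_(i <- s) (1 - a i *: 'X) : {poly R})%R <= (size s).+1)%N /\
  (\prod_(i <- s) (1 - a i *: 'X))`_(size s) = (-1) ^+ size s * \prod_(i <- s) a i.
Proof.
elim: s => [|i s [IHs IH]]; first by rewrite !big_nil size_poly1 coef1 mul1r.
rewrite !big_cons /=; split.
  apply: leq_trans (size_polyMleq _ _) _.
  by have := leq_add (size_1subX (a i)) IHs; rewrite add2n; case: (_ + _)%N.
rewrite -add1n (coefM_top (size_1subX _) IHs) IH coefB coef1 coefZ coefX /= sub0r mulr1.
by rewrite exprS; ring.
Qed.
End CoefTop.

Section Ext.
Context (F : finFieldType).
Local Notation Fbar := (algclosure F).
Local Notation iota := (to_algclosure F).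
Local Notation q := #|F|.

Definition frob (x : Fbar) := x ^+ q.

Fact frob_zmod : zmod_morphism frob.
Proof. by move=> x y; rewrite /frob -(expn1 q) frobD frobN. Qed.
Fact frob_monoid : monoid_morphism frob.
Proof. by split=> [|x y]; rewrite /frob ?expr1n ?exprMn. Qed.
HB.instance Definition _ := GRing.isZmodMorphism.Build _ _ frob frob_zmod.
HB.instance Definition _ := GRing.isMonoidMorphism.Build _ _ frob frob_monoid.

Lemma iter_frob i x : iter i frob x = x ^+ (q ^ i).
Proof. by elim: i => //= i ->; rewrite /frob -exprM -expnSr. Qed.

Lemma frob_iota z : frob (iota z) = iota z.
Proof. by rewrite /frob -rmorphXn /= expf_card. Qed.

Lemma frob_fixed y : frob y = y -> exists z, iota z = y.
Proof.
move=> fy; have yP : y \in in_ext (posint1).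
  by rewrite unfold_in /= expn1; apply/eqP.
by have [z /eqP zE] := ext1_base (Ext yP); exists z.
Qed.

Lemma frob_map_iota u : map_poly frob (map_poly iota u) = map_poly iota u.
Proof. by apply/polyP => i; rewrite !coef_map /= frob_iota. Qed.

(** The fixed field of the Frobenius map is F, so a polynomial with Frobenius
    invariant coefficients comes from F. *)
Lemma poly_descend (p : {poly Fbar}) : map_poly frob p = p ->
  exists p0, map_poly iota p0 = p.
Proof.
move=> fp; have /choice[g gE] i : exists z, iota z = p`_i.
  by apply: frob_fixed; rewrite -{2}fp coef_map.
exists (\poly_(i < size p) g i); apply/polyP => i; rewrite coef_map coef_poly.
case: ltnP => ip; first exact: gE.
by rewrite nth_default // raddf0.
Qed.

Lemma in_ext_iter (d : posint) (x : ext F d) : iter (sval d) frob (val x) = val x.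
Proof. by rewrite iter_frob extE. Qed.

Lemma ext_trace_ex (d : posint) (x : ext F d) :
  exists z, iota z == \sum_(i < sval d) val x ^+ (q ^ i).
Proof.
have := in_ext_iter x; move: (val x) => y yE.
suff /frob_fixed[z <-] : frob (\sum_(i < sval d) y ^+ (q ^ i)) = \sum_(i < sval d) y ^+ (q ^ i).
  by exists z.
rewrite rmorph_sum /=; under eq_bigr do rewrite -iter_frob -iterS.
under [RHS]eq_bigr do rewrite -iter_frob.
case: (sval d) yE => [|m] yE; first by rewrite !big_ord0.
by rewrite big_ord_recr [RHS]big_ord_recl addrC yE.
Qed.

Definition ext_trace (d : posint) (x : ext F d) : F := xchoose (ext_trace_ex x).

Lemma ext_traceE (d : posint) (x : ext F d) :
  iota (ext_trace x) = \sum_(i < sval d) val x ^+ (q ^ i).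
Proof. exact/eqP/(xchooseP (ext_trace_ex x)). Qed.

(** The norm to F itself, rather than to its copy of degree 1. *)
Definition unit_norm (d : posint) (x : {unit ext F d}) : {unit F} :=
  base_unit (@norm_unit F posint1 d (dvd1n _) x).

Lemma unit_normE (d : posint) (x : {unit ext F d}) :
  iota (val (unit_norm x)) = \prod_(i < sval d) val (val x) ^+ (q ^ i).
Proof.
rewrite /unit_norm /= baseK /= /norm_val divn1.
by apply: eq_bigr => i _; rewrite mul1n.
Qed.

(** The product over the r first Frobenius conjugates.  For x of degree d
    dividing r this is a power with exponent r / d of the reciprocal minimal
    polynomial. *)
Definition conjpoly (r : nat) (x : Fbar) : {poly Fbar} :=
  \prod_(i <- seq.iota 0 r) (1 - x ^+ (q ^ i) *: 'X).

Lemma frob_conjpoly r x : iter r frob x = x -> map_poly frob (conjpoly r x) = conjpoly r x.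
Proof.
move=> xE; rewrite /conjpoly !big_iota0 rmorph_prod /=.
transitivity (\prod_(i < r) (1 - iter i.+1 frob x *: 'X : {poly Fbar})).
  apply: eq_bigr => i _; rewrite rmorphB rmorph1 /= map_polyZ /= map_polyX.
  by rewrite -iter_frob.
under [RHS]eq_bigr do rewrite -iter_frob.
case: r xE => [|m] xE; first by rewrite !big_ord0.
by rewrite big_ord_recr [RHS]big_ord_recl mulrC xE.
Qed.

(** The degree r + 1: extensions are indexed from 0 so that sums over the degree
    are sums over ordinals. *)
Definition succ_posint (r : nat) : posint := exist _ r.+1 isT.

Lemma rcharpoly_ex r (x : {unit ext F (succ_posint r)}) :
  exists p0, map_poly iota p0 = conjpoly r.+1 (val (val x)).
Proof. by apply/poly_descend/frob_conjpoly/(in_ext_iter (val x)). Qed.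

(** The descent to F of conjpoly; it is the reciprocal of the characteristic
    polynomial of x over F. *)
Definition rcharpoly r (x : {unit ext F (succ_posint r)}) : {poly F} := sval (cid (rcharpoly_ex x)).

Lemma rcharpolyE r (x : {unit ext F (succ_posint r)}) :
  map_poly iota (rcharpoly x) = conjpoly r.+1 (val (val x)).
Proof. exact: svalP (cid (rcharpoly_ex x)). Qed.

Lemma rcharpoly_coef0 r (x : {unit ext F (succ_posint r)}) : (rcharpoly x)`_0 = 1.
Proof.
apply: (fmorph_inj iota); rewrite -coef_map rcharpolyE rmorph1.
by have [] := psum_prod_1subX (seq.iota 0 r.+1) (fun i => val (val x) ^+ (q ^ i)) (ltn0Sn 0).
Qed.

Lemma rcharpoly_psum n r (x : {unit ext F (succ_posint r)}) : (0 < n)%N ->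
  psum n (rcharpoly x) = ext_trace (val x ^+ n).
Proof.
move=> n0; apply: (fmorph_inj iota); rewrite -psum_map rcharpolyE ext_traceE.
have [_ ->] := psum_prod_1subX (seq.iota 0 r.+1) (fun i => val (val x) ^+ (q ^ i)) n0.
rewrite big_iota0; apply: eq_bigr => i _.
by rewrite rmorphXn /= exprAC.
Qed.

Lemma rcharpoly_size r (x : {unit ext F (succ_posint r)}) : size (rcharpoly x) = r.+2.
Proof.
rewrite -(size_map_poly iota) rcharpolyE.
have [s t] := prod_1subX_top (seq.iota 0 r.+1) (fun i => val (val x) ^+ (q ^ i)).
rewrite size_iota in s t; apply/eqP; rewrite eqn_leq s /=.
rewrite ltnNge; apply/negP => /(nth_default 0); rewrite /conjpoly t => /eqP.
rewrite mulf_eq0 signr_eq0 prodf_seq_eq0 => /hasP[i _]; rewrite /= expf_eq0 => /andP[_ /eqP x0].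
by have := unit_neq0 x; rewrite -val_eqE /= x0 eqxx.
Qed.

Lemma rcharpoly_top r (x : {unit ext F (succ_posint r)}) :
  (-1) ^+ r.+1 * (rcharpoly x)`_r.+1 = val (unit_norm x).
Proof.
apply: (fmorph_inj iota); rewrite unit_normE rmorphM rmorphXn rmorphN1 -coef_map rcharpolyE.
have [_] := prod_1subX_top (seq.iota 0 r.+1) (fun i => val (val x) ^+ (q ^ i)).
rewrite size_iota /conjpoly => ->; rewrite mulrA -exprMn mulrNN mulr1 expr1n mul1r.
by rewrite big_iota0.
Qed.

End Ext.

Section Count.
Context (F : finFieldType).
Local Notation Fbar := (algclosure F).
Local Notation iota := (to_algclosure F).
Local Notation q := #|F|.

(** The inverse roots of conjpoly are the conjugates of x, so its roots are the
    iterates of x^-1 under Frobenius. *)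
Lemma conjpoly_eqp r (x : Fbar) : x != 0 ->
  conjpoly r x %= \prod_(z <- traject (@frob F) x^-1 r) ('X - z%:P).
Proof.
move=> x0; rewrite /conjpoly big_iota0; elim: r => [|r IH].
  by rewrite big_ord0 big_nil eqpxx.
rewrite big_ord_recr trajectSr -cats1 big_cat big_seq1 /=.
rewrite iter_frob exprVn; apply: (eqp_trans (eqp_mulr _ IH)); apply: eqp_mull.
set a := x ^+ _; have a0 : a != 0 by rewrite expf_neq0.
have -> : 1 - a *: 'X = (- a) *: ('X - (a^-1)%:P).
  rewrite scalerBr scaleNr -mul_polyC -[X in _ = _ - X]mul_polyC -polyCM mulNr mulfV //.
  by rewrite polyCN opprK addrC.
by rewrite eqp_scale // oppr_eq0.
Qed.

Lemma sum_count_undup (T : eqType) (s : seq T) :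
  (\sum_(z <- undup s) count_mem z s = size s)%N.
Proof.
transitivity (\sum_(z <- undup s) \sum_(w <- s) (w == z))%N.
  by apply: eq_bigr => z _; rewrite -sum1_count big_mkcond.
rewrite exchange_big /= -sum1_size; apply: eq_big_seq => w ws.
under eq_bigr do rewrite eq_sym.
have -> : (\sum_(z <- undup s) (z == w) = count_mem w (undup s))%N.
  by rewrite -sum1_count [RHS]big_mkcond.
by rewrite count_uniq_mem ?undup_uniq // mem_undup ws.
Qed.

(** Over the algebraic closure, the roots of u form a Frobenius invariant
    multiset s of size m, and rcharpoly x divides u exactly when the first r + 1
    iterates of x^-1 form a submultiset of s.  By orbit_count a root z of u
    accounts for as many pairs as its multiplicity. *)
Lemma card_rcharpoly_dvdp (u : {poly F}) m : u`_0 = 1 -> size u = m.+1 ->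
  (\sum_(r < m) #|[pred x : {unit ext F (succ_posint r)} | (rcharpoly x %| u)%R]| = m)%N.
Proof.
move=> u0 su; set u' := map_poly iota u.
have [s uE] := closed_field_poly_normal u'; set P := \prod_(z <- s) _ in uE.
have u'0 : u' != 0 by rewrite -size_poly_gt0 size_map_poly su.
have lc0 : lead_coef u' != 0 by rewrite lead_coef_eq0.
have uP : u' %= P by rewrite {1}uE eqp_scale.
have ss : size s = m.
  by have := size_map_poly iota u; rewrite -/u' su uE size_scale // size_prod_XsubC => -[].
have s0 : 0 \notin s.
  by rewrite -root_prod_XsubC -(eqp_root uP) rootE horner_coef0 coef_map u0 /= rmorph1 oner_eq0.
have finj : injective (@frob F) by exact: fmorph_inj.
have lcf : frob (lead_coef u') = lead_coef u' by rewrite /u' lead_coef_map /= frob_iota.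
(* u has coefficients in F, so Frobenius permutes its roots with multiplicity. *)
have fP : \prod_(z <- map (@frob F) s) ('X - z%:P) = P.
  apply: (scalerI lc0); transitivity u'; last exact: uE.
  rewrite -[RHS](frob_map_iota u) -/u' [in RHS]uE map_polyZ /= lcf; congr (_ *: _).
  rewrite (rmorph_prod (map_poly (@frob F))) big_map.
  by apply: eq_bigr => z _; rewrite rmorphB /= map_polyX map_polyC.
have stable w : count_mem (frob w) s = count_mem w s.
  rewrite -(seq.permP (prod_XsubC_eq fP)) count_map; apply: eq_count => z /=.
  by rewrite (inj_eq finj).
have dvE r (x : {unit ext F (succ_posint r)}) : (rcharpoly x %| u) =
    submset (traject (@frob F) (val (val x))^-1 r.+1) s.
  have x0 : val (val x) != 0 by have := unit_neq0 x; rewrite -val_eqE.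
  rewrite -(dvdp_map iota) rcharpolyE (eqp_dvdl _ (conjpoly_eqp _ x0)) -/u'.
  by rewrite (eqp_dvdr _ uP) dvdp_prod_submset.
have cardE r : #|[pred x : {unit ext F (succ_posint r)} | rcharpoly x %| u]| =
   count (fun z => (iter r.+1 (@frob F) z == z) && submset (traject (@frob F) z r.+1) s) (undup s).
  rewrite cardE -size_filter -(size_map (fun x : {unit ext F (succ_posint r)} => (val (val x))^-1)).
  apply/perm_size/uniq_perm; rewrite ?filter_uniq ?undup_uniq //.
    by rewrite map_inj_uniq ?enum_uniq // => x y /invr_inj/val_inj/val_inj.
  move=> z; rewrite mem_filter mem_undup; apply/mapP/andP.
    move=> [x]; rewrite mem_enum inE dvE => sub ->; split.
      by rewrite sub andbT iter_frob exprVn -iter_frob (in_ext_iter (val x)).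
    have := submsetP _ _ sub (val (val x))^-1; rewrite -!has_pred1 !has_count.
    by apply: leq_trans; rewrite /= eqxx.
  move=> [/andP[/eqP zE sub] zs].
  have z0 : z != 0 by apply: contraNneq s0 => <-.
  have zP : z^-1 \in in_ext (succ_posint r).
    by rewrite unfold_in /= exprVn -iter_frob zE.
  have zu : Ext zP \is a GRing.unit by rewrite unitfE -val_eqE /= invr_eq0.
  exists (FinRing.unit _ zu); last by rewrite /= invrK.
  by rewrite mem_enum inE dvE /= invrK.
transitivity (\sum_(r < m) \sum_(z <- undup s)
   ((iter r.+1 (@frob F) z == z) && submset (traject (@frob F) z r.+1) s))%N.
  by apply: eq_bigr => r _; rewrite cardE -sum1_count big_mkcond.
rewrite exchange_big /= -[RHS]ss -[RHS]sum_count_undup; apply: eq_big_seq => z.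
rewrite mem_undup => zs; rewrite -(orbit_count finj stable zs) ss.
rewrite -sum1_count [RHS]big_mkcond /= -[X in seq.iota X m]addn0 iotaDl big_map.
by rewrite big_iota0; apply: eq_bigr => r _; rewrite add1n.
Qed.
End Count.

(** * Newton identities for the L-function *)
Section Newton.
Context (C : numClosedFieldType) (F : finFieldType) (psi : F -> C).
Context (psi_char : additive_character psi).
Context (n : nat).
Context (n_gt0 : (0 < n)%N).
Context (eta : mulchar C F).

(** The power sums attached to the L-function; index r stands for degree r + 1. *)
Definition Lpow r := \sum_(x : {unit ext F (succ_posint r)}) eta (unit_norm x) * psi (ext_trace (val x ^+ n)).

Local Notation Lterm := (Lterm psi n eta).
Local Notation Lcoef := (Lcoef psi n eta).

Lemma LtermM a b (u v : {poly F}) : (size u <= a.+1)%N -> (size v <= b.+1)%N ->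
  u`_0 = 1 -> v`_0 = 1 -> Lterm (a + b) (u * v) = Lterm a u * Lterm b v.
Proof.
move=> su sv u0 v0; rewrite /Lterm psumM // psiD // coefM_top // exprD.
by rewrite mulrACA char_ext0M mulrACA.
Qed.

Lemma Lterm_rcharpoly r (x : {unit ext F (succ_posint r)}) :
  Lterm r.+1 (rcharpoly x) = eta (unit_norm x) * psi (ext_trace (val x ^+ n)).
Proof. by rewrite /Lterm rcharpoly_top char_ext0_unit rcharpoly_psum. Qed.

(** Multiplication by rcharpoly x identifies the polynomials of degree at most
    m - (r + 1) with the multiples of rcharpoly x of degree at most m. *)
Lemma Lterm_rcharpoly_sum m r (x : {unit ext F (succ_posint r)}) : (r < m)%N ->
  Lterm r.+1 (rcharpoly x) * Lcoef (m - r.+1)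
  = \sum_(c : 'rV[F]_m | rcharpoly x %| upoly c) Lterm m (upoly c).
Proof.
move=> rm; set p := rcharpoly x; set k := (m - r.+1)%N.
have p0 : p`_0 = 1 by exact: rcharpoly_coef0.
have sp : size p = r.+2 by exact: rcharpoly_size.
have mE : (r.+1 + k = m)%N by rewrite subnKC.
have /choice[h hE] (c : 'rV[F]_k) : exists d : 'rV[F]_m, upoly d = p * upoly c.
  apply: upolyK; first by rewrite coef0M p0 upoly0 mulr1.
  apply: leq_trans (size_polyMleq _ _) _; rewrite sp.
  by have := size_upoly c; rewrite -mE; lia.
have pn0 : p != 0 by rewrite -size_poly_gt0 sp.
have hinj : injective h.
  by move=> c d /(congr1 (@upoly _ _)); rewrite !hE => /(mulfI pn0)/upoly_inj.
transitivity (\sum_(c in [set h d | d : 'rV[F]_k]) Lterm m (upoly c)).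
  rewrite big_imset /=; last by move=> ? ? _ _; exact: hinj.
  rewrite mulr_sumr; apply: eq_big => c; first by rewrite inE.
  by move=> _; rewrite hE -mE LtermM ?upoly0 ?size_upoly // sp.
apply: eq_bigl => c; apply/imsetP/idP => [[d _ ->]|]; first by rewrite hE dvdp_mulr.
case/dvdpP=> w wE; have w0 : w`_0 = 1.
  by have := upoly0 c; rewrite wE coef0M p0 mulr1.
have wn0 : w != 0 by apply: contra_eqN w0 => /eqP ->; rewrite coef0 eq_sym oner_eq0.
have [d dE] : exists d : 'rV[F]_k, upoly d = w.
  apply: upolyK => //; have := size_upoly c.
  by rewrite wE size_mul // sp -mE addnS /= addnC -addnS leq_add2l.
by exists d => //; apply: upoly_inj; rewrite hE dE wE mulrC.
Qed.

(** Expand the right-hand side as a sum over triples (r, x, u) with rcharpoly x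
    dividing u.  A polynomial u with nonzero term has degree exactly m, hence
    occurs m times by card_rcharpoly_dvdp. *)
Lemma Lcoef_newton m :
  Lcoef m *+ m = \sum_(r < m) Lpow r * Lcoef (m - r.+1).
Proof.
transitivity (\sum_(r < m) \sum_(x : {unit ext F (succ_posint r)})
    \sum_(c : 'rV[F]_m | rcharpoly x %| upoly c) Lterm m (upoly c)); last first.
  apply: eq_bigr => r _; rewrite /Lpow mulr_suml; apply: eq_bigr => x _.
  by rewrite -Lterm_rcharpoly_sum // Lterm_rcharpoly.
under [RHS]eq_bigr do rewrite (exchange_big_dep xpredT) //=.
rewrite exchange_big /= /Lcoef -sumrMnl; apply: eq_bigr => c _.
under [RHS]eq_bigr do rewrite sumr_const.
rewrite sumrMnr.
have [c0|cn0] := eqVneq (upoly c)`_m 0.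
  by rewrite /Lterm c0 mulr0 char_ext0_0 mul0r !mul0rn.
congr (_ *+ _); rewrite card_rcharpoly_dvdp ?upoly0 //.
apply/eqP; rewrite eqn_leq size_upoly /= ltnNge; apply: contra cn0 => h.
by rewrite nth_default.
Qed.
End Newton.

Section NewtonSeries.
Context (C : numDomainType).
Implicit Types (s t : nat -> C) (A B : {poly C}).

(** A has the power sums s, that is A' = A * (sum of the s_r X^r). *)
Definition newton s A := forall m, A`_m *+ m = \sum_(r < m) s r * A`_(m - r.+1).

Lemma newtonP s A : newton s A <-> forall M, eq_modX M A^`() (\poly_(r < M) s r * A).
Proof.
have E M m : (m < M)%N -> (\poly_(r < M) s r * A)`_m = \sum_(r < m.+1) s r * A`_(m - r).
  move=> mM; rewrite coefM; apply: eq_bigr => r _; rewrite coef_poly.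
  by rewrite (leq_ltn_trans _ mM) // -ltnS.
split=> [h M m mM|h [|m]].
- by rewrite E // coef_deriv h; apply: eq_bigr => r _; rewrite subSS.
- by rewrite mulr0n big_ord0.
by rewrite -coef_deriv (h m.+1) // E //; apply: eq_bigr => r _; rewrite subSS.
Qed.

Lemma newton_unique s A B : A`_0 = B`_0 -> newton s A -> newton s B -> A = B.
Proof.
move=> AB0 hA hB; apply/polyP => m; elim/ltn_ind: m => -[//|m] IH.
apply/eqP; rewrite -(eqr_pMn2r (ltn0Sn m)); apply/eqP; rewrite hA hB.
by apply: eq_bigr => r _; rewrite IH // subSS ltnS leq_subr.
Qed.

Lemma newtonM s t A B : newton s A -> newton t B ->
  newton (fun r => s r + t r) (A * B).
Proof.
move=> /newtonP hA /newtonP hB; apply/newtonP => M.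
have -> : \poly_(r < M) (s r + t r) * (A * B)
    = \poly_(r < M) s r * A * B + A * (\poly_(r < M) t r * B).
  have -> : \poly_(r < M) (s r + t r) = \poly_(r < M) s r + \poly_(r < M) t r.
    by apply/polyP => i; rewrite coefD !coef_poly; case: ifP; rewrite ?addr0.
  ring.
rewrite derivM => m mM; rewrite !coefD; congr (_ + _); exact: (eq_modXM _ _ mM).
Qed.

Lemma newton_prod (I : Type) (l : seq I) (P : pred I) (s : I -> nat -> C) (A : I -> {poly C}) :
  (forall i, P i -> newton (s i) (A i)) ->
  newton (fun r => \sum_(i <- l | P i) s i r) (\prod_(i <- l | P i) A i).
Proof.
move=> h; elim: l => [|i l IH] m.
  rewrite !big_nil coef1 big1 => [|r _]; last by rewrite big_nil mul0r.
  by case: m => [|m]; rewrite ?mulr0n ?mul0rn.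
under [RHS]eq_bigr do rewrite !big_cons; rewrite big_cons.
by case: ifP => [Pi|_]; [apply: (newtonM (h _ Pi) IH) | exact: IH].
Qed.
End NewtonSeries.

(** * Characters in the direct limit *)
Section NormSurj.
Context (C : fieldType) (F : finFieldType).
Local Notation q := #|F|.

(** On the units of the extension of degree e the norm is raising to the power
    N = (q^e - 1) / (q^d - 1).  An N-th root x of y in the algebraic closure
    satisfies x^(q^e - 1) = y^(q^d - 1) = 1, so it lies in that extension. *)
Lemma norm_unit_surj (d e : posint) (de : (sval d %| sval e)%N) (y : {unit ext F d}) :
  exists x, norm_unit de x = y.
Proof.
have d0 := svalP d; pose Y : algclosure F := ext_val (FinRing.uval y).
have y0 : Y != 0 by have := unit_neq0 y; rewrite -val_eqE.
have YP : Y ^+ (q ^ sval d) = Y by exact: extE.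
set k := (sval e %/ sval d)%N; pose N := (\sum_(i < k) q ^ (sval d * i))%N.
have eE : sval e = (k * sval d)%N by rewrite /k divnK.
have k0 : (0 < k)%N by rewrite divn_gt0 // dvdn_leq ?(svalP e).
have N0 : (0 < N)%N.
  by rewrite /N -(prednK k0) big_ord_recl muln0.
have [x] := @solve_monicpoly _ N (fun i => if i == 0%N then Y else 0) N0.
rewrite -(prednK N0) big_ord_recl /= expr0 mulr1 prednK // big1 ?addr0 => [xE|i _]; last first.
  by rewrite mul0r.
have x0 : x != 0 by apply: contra_neq y0 => x0; rewrite -xE x0 expr0n gtn_eqF.
have NE : (N * (q ^ sval d).-1 = (q ^ sval e).-1)%N.
  rewrite mulnC eE [(k * _)%N]mulnC expnM [RHS]predn_exp; congr (_ * _)%N.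
  by apply: eq_bigr => i _; rewrite expnM.
have qpos j : (0 < q ^ j)%N by rewrite expn_gt0 (ltnW (q_gt1 F)).
have yE : Y ^+ (q ^ sval d).-1 = 1.
  by apply: (mulfI y0); rewrite -exprS prednK // mulr1.
have xP : x \in in_ext e.
  rewrite unfold_in; apply/eqP; rewrite -[(q ^ _)%N]prednK // exprS -NE exprM xE yE mulr1 //.
have xu : Ext xP \is a GRing.unit by rewrite unitfE -val_eqE.
exists (FinRing.unit _ xu); apply/val_inj/val_inj; rewrite /= /norm_val -/Y -xE.
by rewrite -/k /N expr_sum.
Qed.

Lemma char_map_inj (d e : posint) (de : (sval d %| sval e)%N) :
  injective (@char_map C F d e de).
Proof.
move=> f g fg; apply: mulcharPext => y; have [x <-] := norm_unit_surj de y.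
by have := congr1 (fun c : mulchar C _ => c x) fg; rewrite !pullbackE.
Qed.

(** The norms are surjective, so the transition maps of the system of character
    groups are injective. *)
Lemma dinj_inj (d : posint) : injective (@dinj (char_system C F) d).
Proof.
move=> f g /dinjP[e [h1 [h2]]]; rewrite (bool_irrelevance h2 h1).
exact: char_map_inj.
Qed.

Lemma dinjX d (c : mulchar C (ext F d)) n :
  (@dinj (char_system C F) d c ^+ n)%g = dinj (S := char_system C F) (c ^+ n)%g.
Proof.
elim: n => [|n IH]; first by rewrite !expg0; exact: dirlim_oneE.
by rewrite !expgS dinjM IH.
Qed.

Definition lift_char d (chi : mulchar C F) : mulchar C (ext F d) :=
  char_map (dvd1n (sval d) : (sval posint1 %| sval d)%N) (pullback (@base_unitM F) chi).

Lemma lift_charE d chi x : lift_char d chi x = chi (unit_norm x).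
Proof. by rewrite !pullbackE. Qed.

Lemma to_charlimE d chi : to_charlim chi = dinj (S := char_system C F) (lift_char d chi).
Proof. by rewrite (@dinj_map (char_system C F)). Qed.

Lemma to_charlimV chi : (to_charlim chi)^-1%g = to_charlim chi^-1%g :> charlim C F.
Proof.
rewrite /to_charlim; set d := posint1; set x := pullback _ _.
transitivity (@dirlim_inv (char_system C F) (dinj (S := char_system C F) x)) => //.
rewrite dirlim_invE; congr dinj; apply: mulcharPext => u.
by rewrite mulchar_invE !pullbackE mulchar_invE.
Qed.

Lemma to_charlim_eq1 chi : (to_charlim chi == 1%g :> charlim C F) = (chi == 1%g).
Proof.
apply/eqP/eqP => [|->].
  rewrite -[1%g]/(dirlim_one _) (@dirlim_oneE (char_system C F) posint1) => /dinj_inj E.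
  apply: mulcharPext => y.
  have ey : to_algclosure F (val y) \in in_ext posint1.
    by rewrite unfold_in /= expn1 -rmorphXn /= expf_card.
  have yu : Ext ey \is a GRing.unit.
    by rewrite unitfE -val_eqE /= fmorph_eq0 unit_neq0.
  have := congr1 (fun c : mulchar C _ => c (FinRing.unit _ yu)) E.
  rewrite pullbackE !mulchar_oneE => <-; congr (chi _); apply/val_inj/(fmorph_inj (to_algclosure F)).
  by rewrite /= baseK.
rewrite -[RHS]/(dirlim_one _) (@dirlim_oneE (char_system C F) posint1); congr dinj.
by apply: mulcharPext => u; rewrite pullbackE !mulchar_oneE.
Qed.
End NormSurj.

(** The character that pairs with the absolute value of n in a divisor
    D(chi, n), which is up to sign the divisor of a positive exponent. *)
Definition abs_char (C : fieldType) (F : finFieldType) (n : int) (chi : mulchar C F) :=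
  if n is Negz _ then chi^-1%g else chi.

Section Coeff.
Context (C : fieldType) (F : finFieldType).
Implicit Types (xi : charlim C F) (chi : mulchar C F).

Lemma coeff_Dpos xi (chi : charlim C F) n : (0 < n)%N ->
  coeff xi (Dpos chi n) = ((xi ^+ n)%g == chi)%:R.
Proof.
move=> n0; have fin := charlim_torsion_finite chi n0.
rewrite /Dpos fsbig_finite // (big_morph (coeff xi) (coeffD xi) (coeff0 _ _)).
under eq_bigr do rewrite coeffU mul1r.
transitivity ((count_mem xi (fset_set [set zeta | (zeta ^+ n)%g = chi]%classic))%:R : int).
  by rewrite -sum1_count natr_sum [RHS]big_mkcond; apply: eq_bigr => z _ /=; case: (_ == _).
rewrite count_uniq_mem ?fset_uniq // in_fset_set //; congr (nat_of_bool _)%:R.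
by apply/idP/eqP => [/set_mem|/mem_set].
Qed.

Lemma coeff_D xi chi (n : int) : n != 0 ->
  coeff xi (D (to_charlim chi) n)
  = sgz n * ((xi ^+ `|n|)%g == to_charlim (abs_char n chi))%:R.
Proof.
case: n => [[//|n]|n] _ /=; first by rewrite coeff_Dpos // mul1r.
by rewrite coeffN coeff_Dpos // to_charlimV mulN1r.
Qed.
End Coeff.

Section Relation.
Context (C : numClosedFieldType) (F : finFieldType) (psi : F -> C).

(** The roots of lambda^n chi are the products of lambda with the roots of chi;
    the sum of the Gauss sums of all these roots is given by sum_gauss_root. *)
Lemma Lpow_sum r n (lambda chi : mulchar C F) :
  Lpow psi n (lambda ^+ n * chi)%g r
  = \sum_(c : mulchar C (ext F (succ_posint r)))
       ((c ^+ n)%g == lift_char (succ_posint r) chi)%:R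
       * gauss (fun x => psi (ext_trace x)) (lift_char (succ_posint r) lambda * c)%g.
Proof.
set l := lift_char _ lambda; set x := lift_char _ chi.
transitivity (\sum_(y : {unit ext F (succ_posint r)}) (l ^+ n * x)%g y * psi (ext_trace (val y ^+ n))).
  by apply: eq_bigr => y _; rewrite !mulchar_mulE !mulchar_expE !lift_charE.
rewrite -(sum_gauss_root (fun y => psi (ext_trace y))).
rewrite (reindex_inj (mulgI l)) big_mkcond; apply: eq_bigr => c _.
rewrite expgMn; last exact: mulchar_commute.
by rewrite (inj_eq (mulgI _)); case: eqP; rewrite ?mul1r ?mul0r.
Qed.

Context (k : nat) (chi : 'I_k -> mulchar C F) (n : 'I_k -> int).
Context (n_neq0 : forall i, n i != 0).
Context (sumD0 : \sum_(i < k) D (to_charlim (chi i)) (n i) = 0).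

Lemma sum_coeff0 xi :
  \sum_(i < k) sgz (n i) * ((xi ^+ `|n i|)%g == to_charlim (abs_char (n i) (chi i)))%:R = 0.
Proof.
under eq_bigr do rewrite -coeff_D //.
rewrite -(big_morph (coeff xi) (coeffD xi) (coeff0 _ _)).
by move: (congr1 (coeff xi) sumD0); rewrite coeff0.
Qed.

(** By Lpow_sum the left-hand side is a sum over the characters c of the
    extension, in which the Gauss sum of lambda c is multiplied by the
    coefficient of c in the sum of the divisors. *)
Lemma sum_sign_Lpow lambda r :
  \sum_(i < k) (sgz (n i))%:~R
     * Lpow psi `|n i| (lambda ^+ `|n i| * abs_char (n i) (chi i))%g r = 0.
Proof.
under eq_bigr do rewrite Lpow_sum mulr_sumr.
rewrite exchange_big big1 //= => c _.
under eq_bigr do rewrite mulrA.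
rewrite -mulr_suml; set G := gauss _ _.
have := congr1 (fun z : int => z%:~R : C)
  (sum_coeff0 (dinj (S := char_system C F) (d := succ_posint r) c)).
rewrite rmorph_sum mulr0z => E; rewrite (_ : \sum_(i < k) _ = 0) ?mul0r // -[RHS]E.
apply: eq_bigr => i _.
by rewrite rmorphM /= (to_charlimE (succ_posint r)) dinjX (inj_eq (@dinj_inj _ _ _)); case: (_ == _).
Qed.

Lemma card_trivial : #|[set i | (0 <= n i) && (chi i == 1%g)]| = #|[set i | (n i < 0) && (chi i == 1%g)]|.
Proof.
have E i : ((1%g : charlim C F) ^+ `|n i| == to_charlim (abs_char (n i) (chi i)))%g
     = (chi i == 1%g).
  rewrite expg1n eq_sym to_charlim_eq1 /abs_char; case: (n i) => // _.
  by rewrite invg_eq1.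
have := sum_coeff0 1%g; under eq_bigr do rewrite E.
rewrite (bigID (fun i => 0 <= n i)) /=.
rewrite (eq_bigr (fun i => (chi i == 1%g)%:R)) => [|i ni]; last first.
  by rewrite gtr0_sgz ?mul1r // lt0r n_neq0.
rewrite [X in _ + X](eq_bigr (fun i => - (chi i == 1%g)%:R)) => [|i ni]; last first.
  by rewrite ltr0_sgz ?mulN1r // ltNge.
rewrite sumrN => /eqP; rewrite subr_eq0 -!natr_sum eqr_nat => /eqP.
rewrite big_mkcond [X in _ = X -> _]big_mkcond /= => E2.
rewrite -!sum1_card big_mkcond [RHS]big_mkcond /=.
transitivity (\sum_i (if (0 <= n i)%R then (chi i == 1%g : nat) else 0))%N.
  by apply: eq_bigr => i _; rewrite inE; case: (0 <= n i); case: (chi i == 1%g).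
rewrite E2; apply: eq_bigr => i _; rewrite inE ltNge.
by case: (0 <= n i); case: (chi i == 1%g).
Qed.
End Relation.

(** * Comparison of leading coefficients *)
Section TopCoef.
Context (C : numClosedFieldType) (F : finFieldType) (psi : F -> C).
Context (psi_char : additive_character psi).
Context (psi_nontrivial : nontrivial_character psi).

Definition Lpoly n eta := \poly_(m < n.+1) Lcoef psi n eta m.

Section One.
Context (n : nat).
Context (nF : n%:R != 0 :> F).

Let n_gt0 : (0 < n)%N. Proof. by case: n nF => //; rewrite eqxx. Qed.

Lemma coef_Lpoly eta m : (Lpoly n eta)`_m = Lcoef psi n eta m.
Proof. by rewrite coef_poly; case: ltnP => // nm; rewrite Lcoef_gt. Qed.

Lemma newton_Lpoly eta : newton (Lpow psi n eta) (Lpoly n eta).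
Proof.
move=> m; rewrite coef_Lpoly (Lcoef_newton psi_char n_gt0).
by apply: eq_bigr => r _; rewrite coef_Lpoly.
Qed.

Lemma Lcoef_top_neq0 eta : Lcoef psi n eta n != 0.
Proof.
rewrite Lcoef_top // mulf_neq0 ?Lconst_neq0 // mulf_neq0 ?gauss_neq0 //.
by rewrite invr_eq0 char_ext0_neq0 // mulf_neq0 // signr_eq0.
Qed.

Lemma lead_coef_Lpoly eta : lead_coef (Lpoly n eta) = Lcoef psi n eta n.
Proof. by rewrite lead_coef_poly // Lcoef_top_neq0. Qed.

Definition gauss_ratio (lambda chi : mulchar C F) :=
  gauss psi (lambda ^+ n * chi)%g / (char_ext0 lambda (n%:R ^+ n) * gauss psi chi).

(** In the quotient of the two leading coefficients the constant Lconst cancels,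
    and lambda^n takes at (-1)^(n - 1) n the value lambda(n^n), because
    n (n - 1) is even. *)
Lemma gauss_ratioE lambda chi :
  gauss_ratio lambda chi = Lcoef psi n (lambda ^+ n * chi)%g n / Lcoef psi n chi n.
Proof.
rewrite !Lcoef_top //; set u := _ * n%:R; have u0 : u != 0 by rewrite mulf_neq0 // signr_eq0.
have -> : char_ext0 (lambda ^+ n * chi)%g u = char_ext0 lambda (n%:R ^+ n) * char_ext0 chi u.
  rewrite {1 3}/char_ext0 (negbTE u0) mulchar_mulE mulchar_expE; congr (_ * _).
  have -> : lambda (to_unit u) = char_ext0 lambda u by rewrite /char_ext0 (negbTE u0).
  rewrite -char_ext0X /u exprMn -exprM.
  rewrite -signr_odd oddM (_ : odd n.-1 && odd n = false) ?mul1r //.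
  by case: (n) n_gt0 => //= m _; rewrite andbN.
have := char_ext0_neq0 lambda (expf_neq0 n nF); have := char_ext0_neq0 chi u0.
have := Lconst_neq0 psi_char psi_nontrivial nF; have := gauss_neq0 psi_char psi_nontrivial chi.
rewrite /gauss_ratio; move: (gauss _ _) (gauss _ _) (Lconst _ _) (char_ext0 chi u) (char_ext0 _ _) => a b c d e.
by move=> b0 c0 d0 e0; field; rewrite b0 c0 d0 e0.
Qed.
End One.
End TopCoef.

(** Translation by 1 permutes F, so it does not change the sum of its elements. *)
Lemma card_finField_eq0 (F : finFieldType) : #|F|%:R = 0 :> F.
Proof.
have E : \sum_(x : F) x = \sum_(x : F) (x + 1) by rewrite (reindex_inj (addIr 1)).
by apply: (addrI (\sum_(x : F) x)); rewrite addr0 {2}E big_split /= sumr_const.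
Qed.

Lemma coprime_natr_neq0 (F : finFieldType) n : coprime n #|F| -> n%:R != 0 :> F.
Proof.
have [p pP pF] := finPcharP F => co.
rewrite -(dvdn_pcharf pF); apply: contraTN co => pn.
have pq : (p %| #|F|)%N by rewrite (dvdn_pcharf pF) card_finField_eq0.
apply/negP => /eqP co; have : (p %| gcdn n #|F|)%N by rewrite dvdn_gcd pn pq.
by rewrite co dvdn1 => /eqP p1; move: pP; rewrite p1.
Qed.

Section Product.
Context (C : numClosedFieldType) (F : finFieldType) (psi : F -> C).
Context (psi_char : additive_character psi).
Context (psi_nontrivial : nontrivial_character psi).
Local Notation q := (#|F|%:R : C).

Lemma card_neq0 : q != 0.
Proof. by rewrite pnatr_eq0 -lt0n; apply/card_gt0P; exists 0. Qed.

Lemma gauss_inv (mu : mulchar C F) :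
  gauss psi mu^-1%g = char_ext0 mu (-1) * q ^+ (mu != 1%g) / gauss psi mu.
Proof.
have g0 := gauss_neq0 psi_char psi_nontrivial mu; apply: (mulIf g0); rewrite mulfVK //.
have [->|mu1] := eqVneq mu 1%g; last by rewrite mulrC gaussV // expr1.
rewrite invg1 gauss_one // mulrNN expr0 !mulr1 /char_ext0 oppr_eq0 oner_eq0.
by rewrite mulchar_oneE.
Qed.

Definition gauss_factor (lambda chi : mulchar C F) (n : int) :=
  gauss psi (expgz lambda n * chi)%g
  / (lambda (to_unit (n%:~R ^ n)) * gauss psi chi).

Lemma gauss_factor_pos lambda chi n : n%:R != 0 :> F ->
  gauss_factor lambda chi (Posz n) = gauss_ratio psi n lambda chi.
Proof.
by move=> nF; rewrite /gauss_factor /gauss_ratio /char_ext0 expf_eq0 (negbTE nF) andbF.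
Qed.

(** For n = - N with N > 0 both Gauss sums are those of inverse characters, of
    mu = lambda^N chi^-1 and of chi^-1.  By gauss_inv each contributes a value
    at -1 and a power of q; the values at -1 combine to lambda(-1)^N, which
    cancels against lambda((- N)^(- N)). *)
Lemma gauss_factor_neg lambda chi m : m.+1%:R != 0 :> F ->
  gauss_factor lambda chi (Negz m) =
  q ^ (((expgz lambda (Negz m) * chi)%g != 1%g)%:Z - (chi != 1%g)%:Z)
  / gauss_ratio psi m.+1 lambda chi^-1%g.
Proof.
move=> nF; set mu := (lambda ^+ m.+1 * chi^-1)%g.
have muE : (expgz lambda (Negz m) * chi = mu^-1)%g.
  by rewrite /mu invMg invgK mulchar_commute.
rewrite /gauss_factor muE invg_eq1 -[in gauss psi chi](invgK chi) (gauss_inv mu) (gauss_inv chi^-1%g).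
rewrite !invg_eq1 /gauss_ratio -/mu.
set z := to_unit _; have -> : lambda z = (char_ext0 lambda (-1) ^+ m.+1 * char_ext0 lambda (m.+1%:R ^+ m.+1))^-1.
  rewrite -char_ext0X -char_ext0M -exprMn mulN1r -char_ext0V /char_ext0.
  by rewrite invr_eq0 expf_eq0 oppr_eq0 (negbTE nF) andbF.
have muN : char_ext0 mu (-1) = char_ext0 lambda (-1) ^+ m.+1 * char_ext0 chi^-1%g (-1).
  by rewrite /char_ext0 oppr_eq0 oner_eq0 /mu mulchar_mulE mulchar_expE.
have sq : char_ext0 lambda (-1) ^+ m.+1 * char_ext0 lambda (-1) ^+ m.+1 = 1.
  by rewrite -exprMn -char_ext0M mulrNN mulr1 char_ext0_1 expr1n.
rewrite muN expfzDr ?card_neq0 // -!exprnP -exprnN.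
have := gauss_neq0 psi_char psi_nontrivial mu; have := gauss_neq0 psi_char psi_nontrivial chi^-1%g.
have := char_ext0_neq0 lambda (expf_neq0 m.+1 nF).
have N1 : (-1 : F) != 0 by rewrite oppr_eq0 oner_eq0.
have := char_ext0_neq0 chi^-1%g N1.
have := expf_neq0 (mu != 1%g) card_neq0; have := expf_neq0 (chi != 1%g) card_neq0.
move: sq; move: (gauss _ _) (gauss _ _) (q ^+ _) (q ^+ _) (char_ext0 lambda (_ ^+ _)) (char_ext0 _ (-1)) (_ ^+ m.+1).
move=> a b c d e f s sq c0 d0 f0 e0 b0 a0.
have s0 : s != 0 by apply: contra_eq_neq sq => ->; rewrite mul0r eq_sym oner_neq0.
have -> : (s * e)^-1 = s * e^-1.
  by rewrite invfM; congr (_ * _); apply: (mulfI s0); rewrite sq mulfV.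
field.
by rewrite ?a0 ?b0 ?c0 ?e0 ?f0 ?s0.
Qed.

Context (k : nat) (chi : 'I_k -> mulchar C F) (n : 'I_k -> int).
Context (n_coprime : forall i, coprimez (n i) #|F|%:Z).
Context (sumD0 : \sum_(i < k) D (to_charlim (chi i)) (n i) = 0).

Lemma absn_neq0 i : `|n i|%:R != 0 :> F.
Proof. by apply: coprime_natr_neq0; have := n_coprime i. Qed.

Lemma n_neq0 i : n i != 0.
Proof. by have := absn_neq0 i; apply: contraNneq => ->. Qed.

Let nu i := abs_char (n i) (chi i).

(** The logarithmic derivatives agree by sum_sign_Lpow, and a polynomial with
    constant coefficient 1 in characteristic 0 is determined by its power
    sums. *)
Lemma prod_Lpoly lambda :
  \prod_(i | 0 <= n i) Lpoly psi `|n i| (lambda ^+ `|n i| * nu i)%g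
  = \prod_(i | ~~ (0 <= n i)) Lpoly psi `|n i| (lambda ^+ `|n i| * nu i)%g.
Proof.
have coef0_prod (P : pred 'I_k) : (\prod_(i | P i) Lpoly psi `|n i| (lambda ^+ `|n i| * nu i)%g)`_0 = 1.
  apply: (big_ind (fun p : {poly C} => p`_0 = 1)); first by rewrite coef1.
    by move=> x y x1 y1; rewrite coef0M x1 y1 mulr1.
  by move=> i _; rewrite coef_Lpoly ?absn_neq0 // Lcoef0.
have newton_P (P : pred 'I_k) := newton_prod (index_enum _) (P := P)
  (fun i _ => newton_Lpoly psi_char psi_nontrivial (absn_neq0 i) (lambda ^+ `|n i| * nu i)%g).
apply: newton_unique (newton_P _) _; first by rewrite !coef0_prod.
move=> m; rewrite newton_P; apply: eq_bigr => r _; congr (_ * _).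
have := sum_sign_Lpow psi n_neq0 sumD0 lambda r.
rewrite (bigID (fun i => 0 <= n i)) /= => /eqP; rewrite addr_eq0 -sumrN => /eqP E.
transitivity (\sum_(i | ~~ (0 <= n i)) - ((sgz (n i))%:~R * Lpow psi `|n i| (lambda ^+ `|n i| * nu i)%g r)).
  by apply: eq_bigr => i ni; rewrite ltr0_sgz ?ltNge // mulN1r opprK.
by rewrite -E; apply: eq_bigr => i ni; rewrite gtr0_sgz ?lt0r ?n_neq0 // mul1r.
Qed.

Lemma prod_ratio lambda :
  \prod_(i | 0 <= n i) gauss_ratio psi `|n i| lambda (nu i)
  = \prod_(i | ~~ (0 <= n i)) gauss_ratio psi `|n i| lambda (nu i).
Proof.
have top l : \prod_(i | 0 <= n i) Lcoef psi `|n i| (l ^+ `|n i| * nu i)%g `|n i|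
  = \prod_(i | ~~ (0 <= n i)) Lcoef psi `|n i| (l ^+ `|n i| * nu i)%g `|n i|.
  have := congr1 lead_coef (prod_Lpoly l); rewrite !lead_coef_prod.
  under eq_bigr do rewrite lead_coef_Lpoly ?absn_neq0 //.
  by under [in RHS]eq_bigr do rewrite lead_coef_Lpoly ?absn_neq0 //.
(* The denominators are the leading coefficients for the trivial lambda. *)
have one i : (1 ^+ `|n i| * nu i = nu i)%g by rewrite expg1n mul1g.
under eq_bigr do rewrite gauss_ratioE ?absn_neq0 // -[in X in _ / X]one.
under [RHS]eq_bigr do rewrite gauss_ratioE ?absn_neq0 // -[in X in _ / X]one.
by rewrite !prodf_div !top.
Qed.

(** The exponent is a sum over negative n_i only.  When no lambda^n_i chi_i is
    trivial it counts the negative n_i with chi_i trivial, which is half of all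
    such i by card_trivial. *)
Lemma gauss_product lambda : exists m : int,
    \prod_(i < k) gauss_factor lambda (chi i) (n i) = q ^ m
    /\ ((forall i, (expgz lambda (n i) * chi i)%g <> 1%g) ->
        2 * m = #|[set i | chi i == 1%g]|%:Z).
Proof.
pose e i : int := ((expgz lambda (n i) * chi i)%g != 1%g)%:Z - (chi i != 1%g)%:Z.
exists (\sum_(i | ~~ (0 <= n i)) e i); split.
  rewrite (bigID (fun i => 0 <= n i)) /=.
  rewrite (eq_bigr (fun i => gauss_ratio psi `|n i| lambda (nu i))) => [|i]; last first.
    by rewrite /nu; case: (n i) (absn_neq0 i) => // m mF _; rewrite gauss_factor_pos.
  rewrite prod_ratio -big_split /=.
  rewrite (big_morph (fun m : int => q ^ m) (fun a b => expfzDr a b card_neq0) (expr0z _)).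
  apply: eq_bigr => i; rewrite /e /nu; have := absn_neq0 i.
  case: (n i) => // m mF _; rewrite gauss_factor_neg // mulrC divfK //.
  by rewrite gauss_ratioE // mulf_neq0 ?invr_eq0 ?Lcoef_top_neq0.
move=> ne.
have -> : [set i | chi i == 1%g] = [set i | (0 <= n i) && (chi i == 1%g)] :|: [set i | (n i < 0) && (chi i == 1%g)].
  by apply/setP => i; rewrite !inE -andb_orl leNgt orNb.
rewrite cardsU (_ : _ :&: _ = finset.set0) ?cards0 ?subn0; last first.
  by apply/setP => i; rewrite !inE ltNge; case: (0 <= n i); rewrite ?andbF.
rewrite (card_trivial n_neq0 sumD0) addnn -mul2n PoszM; congr (_ * _).
rewrite -sum1_card -natz natr_sum big_mkcond [RHS]big_mkcond; apply: eq_bigr => i _.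
rewrite inE -ltNge /e; case: ifP => //= _.
have /eqP/negbTE -> := ne i.
by case: (chi i == 1%g).
Qed.
End Product.

Theorem corollary3p2p1 (R : realType) (F : finFieldType) (psi : F -> R[i])
    (psi_char : additive_character psi) (psi_nontrivial : nontrivial_character psi)
    (k : nat) (chi : 'I_k -> mulchar R[i] F) (n : 'I_k -> int)
    (n_coprime : forall i, coprimez (n i) #|F|%:Z)
    (sumD0 : \sum_(i < k) D (to_charlim (chi i)) (n i) = 0)
    (lambda : mulchar R[i] F) :
  exists m : int,
    \prod_(i < k)
        (gauss psi (expgz lambda (n i) * chi i)%g
         / (lambda (to_unit ((n i)%:~R ^ n i)) * gauss psi (chi i)))
      = #|F|%:R ^ m
    /\ ((forall i, (expgz lambda (n i) * chi i)%g <> 1%g) ->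
        2 * m = #|[set i | chi i == 1%g]|%:Z).
Proof. exact: (gauss_product psi_char psi_nontrivial n_coprime sumD0 lambda). Qed.
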